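(* Suppose that $\xi>\max\{4(B+1),8\}$ is such that $\sqrt N(\log N)^{\xi}=O(\theta_N)$ and $\theta_N=O(N)$, and that $h_1,\dots,h_k$ are Lipschitz continuous on $[0,1]$ and orthonormal in $L^2[0,1]$. Then for each $1\le i\le k$, as $N\to\infty$, $$\|v_i-e_i\|_\infty=O_{hp}\left(\frac{(\log N)^{\xi/4}}{\theta}\right)=o_{hp}\left(\frac1{\sqrt N}\right).$$
   Context: Model: fix an integer $k\ge1$, constants $\alpha_1>\alpha_2>\dots>\alpha_k>0$, a constant $B>0$, and a bounded Riemann-integrable function $f:[0,1]^2\to[0,\infty)$. For each $N$, $W=W_N$ is the $N\times N$ random symmetric matrix $W_N(j,\ell)=X_{j\wedge\ell,\,j\vee\ell}$, where $\{X_{j,\ell}:1\le j\le\ell\le N\}$ are independent (not necessarily identically distributed) real random variables with mean $0$, variance $f(j/N,\ell/N)$, and $\mathbb E|X_{j,\ell}|^m\le m^{Bm}$ for all $m\ge1$. Given functions $h_1,\dots,h_k:[0,1]\to\mathbb R$, let $e_i\in\mathbb R^N$ be the column vector with $\ell$-th entry $h_i(\ell/N)/\sqrt N$. For a deterministic scalar $\theta=\theta_N>0$ put $A=A_N=W_N+\theta_N\sum_{i=1}^k\alpha_i e_ie_i'$ (prime denotes transpose). $\lambda_1(A)\ge\dots\ge\lambda_N(A)$ are the ordered eigenvalues of $A$, and for $1\le i\le k$, $v_i$ is a (measurably chosen) unit eigenvector of $A$ for $\lambda_i(A)$, with sign chosen so that $e_i'v_i\ge0$. $\|\cdot\|_\infty$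 is the maximum absolute entry. Events $E_N$ occur with high probability (w.h.p.) if $P(E_N^c)=O(e^{-(\log N)^\eta})$ for some $\eta>1$. $Y_N=O_{hp}(Z_N)$ means there is a constant $C>0$ with $|Y_N|\le C|Z_N|$ w.h.p.; $Y_N=o_{hp}(Z_N)$ means that for every $\delta>0$, $|Y_N|\le\delta|Z_N|$ w.h.p. *)

(* Defs.v *)
From HB Require Import structures.
From mathcomp Require Import all_boot all_order all_algebra finmap.
From mathcomp Require Import all_classical all_reals all_analysis.

Set Implicit Arguments.
Unset Strict Implicit.
Unset Printing Implicit Defensive.

Import Order.TTheory GRing.Theory Num.Theory.
Import numFieldNormedType.Exports.

Local Open Scope classical_set_scope.
Local Open Scope ring_scope.

(* A partition of `[0, 1]` is given by its points other than 0, as in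
   [itv_partition], so the points are those of [0 :: s]. *)
Definition mesh_lt (R : realType) (s : seq R) (delta : R) : Prop :=
  forall i, (i < size s)%N -> s`_i - (0 :: s)`_i < delta.

Definition riemann_sum (R : realType) (f : R -> R -> R) (s t : seq R)
    (c : nat -> nat -> R * R) : R :=
  \sum_(0 <= i < size s) \sum_(0 <= j < size t)
    f (c i j).1 (c i j).2 * (s`_i - (0 :: s)`_i) * (t`_j - (0 :: t)`_j).

Definition tags_in_cells (R : realType) (s t : seq R)
    (c : nat -> nat -> R * R) : Prop :=
  forall i j, (i < size s)%N -> (j < size t)%N ->
    (0 :: s)`_i <= (c i j).1 <= s`_i /\ (0 :: t)`_j <= (c i j).2 <= t`_j.

Definition riemann_integrable_unit_square (R : realType) (f : R -> R -> R) :
    Prop :=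
  exists I : R, forall eps : R, 0 < eps ->
    exists2 delta : R, 0 < delta &
      forall (s t : seq R) (c : nat -> nat -> R * R),
        itv_partition 0 1 s -> itv_partition 0 1 t ->
        mesh_lt s delta -> mesh_lt t delta -> tags_in_cells s t c ->
        `|riemann_sum f s t c - I| < eps.

Definition mutually_independent (d : measure_display) (T : measurableType d)
    (R : realType) (P : probability T R) (I : choiceType) (D : set I)
    (Y : I -> {RV P >-> R}) : Prop :=
  forall J : {fset I}, [set` J] `<=` D ->
  forall B : I -> set R, (forall i, i \in J -> measurable (B i)) ->
    P (\bigcap_(i in [set` J]) (Y i @^-1` B i)) =
    (\prod_(i <- J) P (Y i @^-1` B i))%E.

(* The ordinal [j : 'I_N] encodes the 1-based index j + 1, hence [j.+1]. *)
Definition gridpt (R : realType) (N : nat) (j : 'I_N) : R :=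
  j.+1%:R / N%:R.
Arguments gridpt {R N} j.

Definition sym_mx (R : realType) (N : nat) (x : 'I_N -> 'I_N -> R) :
    'M[R]_N :=
  \matrix_(j, l) (if (j <= l)%N then x j l else x l j).

Definition evec (R : realType) (N : nat) (g : R -> R) : 'cV[R]_N :=
  \col_l (g (gridpt l) / Num.sqrt N%:R).
Arguments evec {R} N g.

Definition perturbed_mx (R : realType) (N k : nat) (W : 'M[R]_N) (theta : R)
    (alpha : 'I_k -> R) (h : 'I_k -> R -> R) : 'M[R]_N :=
  W + theta *: \sum_i alpha i *: (evec N (h i) *m (evec N (h i))^T).

(* Eigenvalues with multiplicity in nonincreasing order; the list is
   determined by the characteristic polynomial and is [::] (by default) only if
   that polynomial does not split or [N = 0]. *)
Definition ordered_eigenvalues (R : realType) (N : nat) (A : 'M[R]_N) : seq R :=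
  xget [::] [set s | sorted >=%R s /\ char_poly A = \prod_(x <- s) ('X - x%:P)].

(* Indexed from 0: [lambda A 0] is the largest eigenvalue. *)
Definition lambda (R : realType) (N : nat) (A : 'M[R]_N) (i : nat) : R :=
  (ordered_eigenvalues A)`_i.

Definition unit_eigenvector (R : realType) (N : nat) (A : 'M[R]_N) (a : R)
    (u : 'cV[R]_N) : Prop :=
  A *m u = a *: u /\ u^T *m u = 1%:M.

Definition whp (R : realType) (d : nat -> measure_display)
    (T : forall N, measurableType (d N)) (P : forall N, probability (T N) R)
    (E : forall N, set (T N)) : Prop :=
  (forall N, measurable (E N)) /\
  exists2 eta : R, 1 < eta &
    (fun N => fine (P N (~` E N))) =O_\oo
      (fun N => expR (- (ln N%:R `^ eta)) : R).

Definition Ohp (R : realType) (d : nat -> measure_display)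
    (T : forall N, measurableType (d N)) (P : forall N, probability (T N) R)
    (Y Z : forall N, T N -> R) : Prop :=
  exists2 C : R, 0 < C &
    whp P (fun N => [set w | `|Y N w| <= C * `|Z N w| ]).

Definition ohp (R : realType) (d : nat -> measure_display)
    (T : forall N, measurableType (d N)) (P : forall N, probability (T N) R)
    (Y Z : forall N, T N -> R) : Prop :=
  forall delta : R, 0 < delta ->
    whp P (fun N => [set w | `|Y N w| <= delta * `|Z N w| ]).

(* Main.v *)
(* Write W for the noise, K = (log N)^(xi/4), kappa = K sqrt N, and let lambda be
   the i-th eigenvalue. Iterating A v = lambda v gives
     v = \sum_(n < m) theta / lambda^(n+1) \sum_j alpha_j (e_j'v) W^n e_j
         + W^m v / lambda^m,   m ~ log N.
   With overwhelming probability |W^n e_j|_oo <= kappa^n / sqrt N and |W| <= kappa;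
   since lambda ~ theta alpha_i, the terms n >= 1 and the remainder are
   O(kappa / (theta sqrt N)) = O(K / theta), and the n = 0 term is
   e_i + O(K / theta). Both bounds on W come from one moment estimate for
   ((W^n g)(l))^r: expanded over r walks of length n started at l, only the walks
   using every edge at least twice contribute; such walks visit at most rn/2 + 1
   vertices, and the crude count (rn/2 + 1)^(rn) N^(rn/2 + 1) of these, times the
   bound (rn)^(B rn + 1) on each expectation, suffices because
   xi/4 > B + 1. The location of lambda follows because every eigenvector with a
   large eigenvalue is close to a single e_m, orthogonal eigenvectors cannot share
   m, and each theta alpha_m is an approximate eigenvalue of A. *)
Require Import Defs.
From HB Require Import structures.
From mathcomp Require Import all_boot all_order all_algebra finmap.
From mathcomp Require Import perm complex.
From mathcomp Require Import all_classical all_reals all_analysis measurable_realfun.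
From mathcomp Require Import ring lra zify.

Set Implicit Arguments.
Unset Strict Implicit.
Unset Printing Implicit Defensive.

Import Order.TTheory GRing.Theory Num.Theory.
Import numFieldNormedType.Exports.

Local Open Scope classical_set_scope.
Local Open Scope ring_scope.

(** * Spectral theorem for real symmetric matrices *)

(** The probabilistic and the spectral halves meet at one interface: off a set of tiny probability,
    [|W x| <= kappa |x|] and the entries of [W^n e_j] are at most [kappa^n / sqrt N]. All the rest
    is deterministic, with constants depending only on the [alpha i] and a sup bound for the [h i].
    After division by [theta] the small parameter is [eps = kappa / theta], and the target is
    [eps / sqrt N]. Euclidean estimates alone give only [eps]. The expansion gains the missing
    [1 / sqrt N] because it moves the sup norm from the random [v] to the deterministic [e_j], for
    which moments can be computed; only the remainder still contains [v]. The eigenvalue is located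
    only within a fixed radius of [alpha i]. The coefficient of [e_i] is near 1 not because [lambda]
    is known well, but because [v] is a unit vector close to a multiple of [e_i] with prescribed
    sign. The number of iterations and the orders of the moments are governed by one [p] of size
    [(log N)^eta], where [1 < eta < xi / (4 (B + 1))]: the lower bound yields the required
    probability, the upper one keeps [(8 p)^(B + 1)] below [(log N)^(xi / 4)]. *)

Lemma symmetric_eigenvector (R : realType) (n : nat) (A : 'M[R]_n.+1) :
  A^T = A -> exists (a : R) (x : 'rV[R]_n.+1), x != 0 /\ x *m A = a *: x.
Proof.
move=> sA; pose AC := map_mx (real_complex R) A.
have hA : AC \is hermsymmx.
  apply: realsym_hermsym.
    apply/is_hermitianmxP; rewrite expr0 scale1r; apply/matrixP => i j.
    by rewrite !mxE -[in LHS]sA mxE.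
  by apply/mxOverP => i j; rewrite mxE; apply/complex_realP; exists (A i j).
have /hermitian_normalmx /orthomx_spectralP AE := hA.
have /mxOverP/(_ ord0 ord0)/complex_realP[a aE] := hermitian_spectral_diag_real hA.
have ev : eigenvalue AC a%:C%C.
  apply/eigenvalueP; exists (row 0 (spectralmx AC)).
    rewrite -row_mul {2}AE !mulmxA mulmxV ?spectral_unit// mul1mx row_mul.
    by rewrite row_diag_mx -scalemxAl -rowE aE.
  apply/eqP => r0; have := spectral_unit AC.
  rewrite unitmxE unitfE => /negP; apply; apply/det0P.
  exists (delta_mx 0 0); last by rewrite -rowE.
  by apply/eqP => /matrixP/(_ 0 0)/eqP; rewrite !mxE !eqxx oner_eq0.
(* Being an eigenvalue means being a root of the characteristic polynomial, and this descends from
   [R[i]] to [R], where it yields a real eigenvector. *)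
have : eigenvalue A a.
  rewrite eigenvalue_root_char -(fmorph_root (real_complex R)).
  by rewrite map_char_poly -eigenvalue_root_char.
by move=> /eigenvalueP[x xA x0]; exists a, x.
Qed.

Lemma row_norm_gt0 (R : realFieldType) n (x : 'rV[R]_n) :
  x != 0 -> 0 < (x *m x^T) 0 0.
Proof.
move=> x0; rewrite lt_neqAle; apply/andP; split; last first.
  by rewrite mxE sumr_ge0// => i _; rewrite mxE -expr2 sqr_ge0.
apply: contra_neq x0 => /esym/eqP.
rewrite mxE psumr_eq0 => [|i _]; last by rewrite mxE -expr2 sqr_ge0.
move=> /allP h; apply/rowP => i; have := h i (mem_index_enum i).
by rewrite /= !mxE -expr2 sqrf_eq0 => /eqP.
Qed.

(** Reflection in the hyperplane orthogonal to [x - delta_mx 0 0], which swaps these two unit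
    vectors; if they coincide, the identity serves. *)
Lemma householder (R : realFieldType) n (x : 'rV[R]_n.+1) :
  x *m x^T = 1%:M ->
  exists H : 'M[R]_n.+1, [/\ H^T = H, H *m H = 1%:M & delta_mx 0 0 *m H = x].
Proof.
move=> x1; have [u uE] : exists u, u = x - delta_mx 0 0 by eexists.
have [u0|u0] := eqVneq u 0.
  exists 1%:M; split; rewrite ?trmx1 ?mul1mx ?mulmx1//.
  by apply/esym/eqP; rewrite -subr_eq0 -uE u0.
have s0 := row_norm_gt0 u0; set s := (u *m u^T) 0 0 in s0.
have uu : u *m u^T = s%:M by rewrite [LHS]mx11_scalar.
exists (1%:M - (2 / s) *: (u^T *m u)); split.
- by rewrite linearB /= trmx1 linearZ /= trmx_mul trmxK.
- have MM : (u^T *m u) *m (u^T *m u) = s *: (u^T *m u).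
    by rewrite mulmxA -[u^T *m u *m u^T]mulmxA uu mul_mx_scalar -scalemxAl.
  rewrite mulmxBl mul1mx mulmxBr mulmx1 -scalemxAl -scalemxAr.
  rewrite MM !scalerA -[RHS]subr0 -addrA -opprD; congr (_ - _).
  rewrite -scalerBl -scalerDl (_ : _ + _ = 0) ?scale0r//.
  by field; rewrite gt_eqF.
- rewrite mulmxBr mulmx1 -scalemxAr mulmxA.
  have du : delta_mx 0 0 *m u^T = (x 0 0 - 1)%:M :> 'M[R]_1.
    by rewrite uE [LHS]mx11_scalar -rowE !mxE !eqxx.
  (* Both vectors are unit, so [|u|^2] is determined by their inner product [x 0 0]; this makes the
     coefficient of [u] below equal to -1. *)
  have sE : s = 2 - 2 * x 0 0.
    rewrite /s uE linearB /= mulmxBr !mulmxBl x1.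
    rewrite -[delta_mx 0 0 *m x^T]trmxK trmx_mul trmxK -[x *m _]trmxK trmx_mul.
    rewrite !trmxK trmx_delta -!rowE !mxE !eqxx !andbT/=; ring.
  rewrite du mul_scalar_mx scalerA (_ : _ * _ = -1); last first.
    by move: s0; rewrite sE => s0; field; rewrite gt_eqF.
  by rewrite scaleN1r opprK uE addrC subrK.
Qed.

(** Deflation: a Householder matrix sends the first basis vector to a unit eigenvector, symmetry
    then clears the first row and column off the diagonal, and induction treats the remaining block.
    The rows of [Q] are the eigenvectors. *)
Theorem spectral_symmetric (R : realType) (n : nat) (A : 'M[R]_n) :
  A^T = A ->
  exists (Q : 'M[R]_n) (d : 'rV[R]_n),
    Q *m Q^T = 1%:M /\ Q *m A = diag_mx d *m Q.
Proof.
elim: n A => [|n IH] A sA.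
  by exists 1%:M, 0; split; apply/matrixP => -[].
have [a [x0 [x0n x0A]]] := symmetric_eigenvector sA.
have s0 := row_norm_gt0 x0n; set s := (x0 *m x0^T) 0 0 in s0.
pose x := (Num.sqrt s)^-1 *: x0.
have xA : x *m A = a *: x by rewrite -scalemxAl x0A !scalerA mulrC.
have x1 : x *m x^T = 1%:M.
  rewrite [LHS]mx11_scalar linearZ /= -scalemxAl -scalemxAr scalerA mxE -/s.
  by rewrite -invfM -expr2 sqr_sqrtr ?ltW// mulVf// gt_eqF.
have [H [sH HH dH]] := householder x1.
have [B BH] : exists B : 'M[R]_(1 + n), B = H *m A *m H by eexists.
have sB : B^T = B by rewrite BH !trmx_mul sH sA mulmxA.
have rB : delta_mx 0 0 *m B = a *: (delta_mx 0 0 : 'rV[R]_(1 + n)).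
  by rewrite BH !mulmxA dH xA -scalemxAl -dH -mulmxA HH mulmx1.
have ul0 : ulsubmx B = a%:M.
  apply/matrixP => i j; rewrite !ord1 !mxE eqxx.
  have /matrixP/(_ 0 0) := rB; rewrite -rowE !mxE !eqxx/= mulr1 => <-.
  by congr (B _ _); apply/val_inj.
have ur0 : ursubmx B = 0.
  apply/matrixP => i j; rewrite !ord1 !mxE.
  have /matrixP/(_ 0 (rshift 1 j)) := rB; rewrite -rowE !mxE/= mulr0 => <-.
  by congr (B _ _); apply/val_inj.
have dl0 : dlsubmx B = 0.
  apply/matrixP => i j; rewrite !mxE -sB mxE.
  by have /matrixP/(_ j i) := ur0; rewrite !mxE.
have BE : B = block_mx a%:M 0 0 (drsubmx B) by rewrite -ul0 -ur0 -dl0 submxK.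
have [|Q' [d' [Q1 QA]]] := IH (drsubmx B).
  by rewrite trmx_drsub sB.
pose K : 'M[R]_(1 + n) := block_mx 1%:M 0 0 Q'.
have KB : K *m B = diag_mx (row_mx a%:M d') *m K.
  rewrite BE /K diag_mx_row !mulmx_block !mul0mx !mulmx0 !mul1mx !addr0 !add0r.
  rewrite mulmx1 QA; congr block_mx; apply/matrixP => i j.
  by rewrite !mxE !ord1 !eqxx mulr1n.
have KK : K *m K^T = 1%:M.
  rewrite /K tr_block_mx mulmx_block !trmx0 !trmx1 !mul0mx !mulmx0 !mul1mx.
  by rewrite !addr0 !add0r Q1 -scalar_mx_block.
exists (K *m H), (row_mx a%:M d'); split.
  by rewrite trmx_mul sH mulmxA -[K *m H *m H]mulmxA HH mulmx1.
have HA : H *m A = B *m H by rewrite BH -!mulmxA HH mulmx1.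
by rewrite -mulmxA HA !mulmxA KB.
Qed.

Lemma char_poly_diag (R : realType) (n : nat) (A Q : 'M[R]_n) (d : 'rV[R]_n) :
  Q *m Q^T = 1%:M -> Q *m A = diag_mx d *m Q ->
  char_poly A = \prod_(i < n) ('X - (d 0 i)%:P).
Proof.
move=> QQ QA; have Qu : Q \in unitmx by have [] := mulmx1_unit QQ.
have dQ : \det (map_mx polyC Q) != 0.
  by rewrite det_map_mx polyC_eq0 -unitfE -unitmxE.
transitivity (char_poly (diag_mx d)); last first.
  rewrite char_poly_trig; last exact/is_diag_mx_is_trig/diag_mx_is_diag.
  by apply: eq_bigr => i _; rewrite mxE eqxx.
apply: (mulIf dQ); rewrite mulrC -!det_mulmx; congr (\det _).
rewrite /char_poly_mx mulmxBr mulmxBl -!map_mxM QA; congr (_ - _).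
by rewrite scalar_mxC.
Qed.

Definition dot (R : realType) (N : nat) (x y : 'cV[R]_N) : R := (x^T *m y) 0 0.

(** The list picked by [ordered_eigenvalues] is known only through its order and the characteristic
    polynomial. Unique factorization makes it a permutation of the diagonal given by the spectral
    theorem, and the same permutation reorders the rows of [Q]. *)
Lemma ordered_eigenbasis (R : realType) (N : nat) (A : 'M[R]_N) :
  A^T = A ->
  exists q : 'I_N -> 'cV[R]_N,
    [/\ forall i, A *m q i = lambda A i *: q i,
        forall i j, dot (q i) (q j) = (i == j)%:R &
        forall i j : 'I_N, (i <= j)%N -> lambda A j <= lambda A i].
Proof.
move=> sA; have [Q [d [QQ QA]]] := spectral_symmetric sA.
have cA := char_poly_diag QQ QA.
pose t := [tuple d 0 i | i < N].
have ct : char_poly A = \prod_(x <- t) ('X - x%:P).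
  by rewrite cA big_tuple; apply: eq_bigr => i _; rewrite tnth_mktuple.
pose S : set (seq R) := [set s | sorted >=%R s /\ char_poly A = \prod_(x <- s) ('X - x%:P)].
have St : S (sort >=%R t).
  split; first by apply: sort_sorted => x y; exact: le_total.
  by rewrite ct; apply: perm_big; rewrite perm_sym; apply/permPl/perm_sort.
have [so cs] : S (ordered_eigenvalues A) := xgetPex [::] (ex_intro _ _ St).
have pe : perm_eq (ordered_eigenvalues A) t.
  by apply: prod_XsubC_eq; rewrite -cs ct.
have sz : size (ordered_eigenvalues A) = N by rewrite (perm_size pe) size_tuple.
have /tuple_permP[p pE] := pe.
have lE (i : 'I_N) : lambda A i = d 0 (p i).
  rewrite /lambda pE (nth_map i) ?size_enum_ord//.
  by rewrite tnth_mktuple nth_ord_enum.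
exists (fun i => (row (p i) Q)^T); split.
- move=> i; rewrite lE -[A]trmxK sA -trmx_mul -row_mul QA row_mul row_diag_mx.
  by rewrite -scalemxAl -rowE linearZ.
- move=> i j; rewrite /dot trmxK.
  rewrite -(inj_eq (@perm_inj _ p)).
  have /matrixP/(_ (p i) (p j)) := QQ; rewrite !mxE => <-.
  by apply: eq_bigr => k _; rewrite !mxE.
- move=> i j ij; rewrite /lambda.
  apply: (@sorted_leq_nth _ >=%R _ _ 0 _ so); rewrite ?inE ?sz//; last exact: lexx.
  by move=> y x z yx zy; exact: le_trans zy yx.
Qed.


(** * Euclidean norm and operator norm *)

Definition nrm (R : realType) (N : nat) (x : 'cV[R]_N) : R := Num.sqrt (dot x x).

Definition iter_mx (R : realType) (N : nat) (W : 'M[R]_N) (n : nat)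
    (x : 'cV[R]_N) : 'cV[R]_N :=
  iter n (mulmx W) x.

Section Euclidean.
Context {R : realType} {N : nat}.
Implicit Types (x y z : 'cV[R]_N) (W : 'M[R]_N).

Lemma dotE x y : dot x y = \sum_i x i 0 * y i 0.
Proof. by rewrite /dot mxE; apply: eq_bigr => i _; rewrite mxE. Qed.

Lemma dotC x y : dot x y = dot y x.
Proof. by rewrite !dotE; apply: eq_bigr => i _; rewrite mulrC. Qed.

Lemma dotDr x y z : dot x (y + z) = dot x y + dot x z.
Proof. by rewrite /dot mulmxDr mxE. Qed.

Lemma dotZr a x y : dot x (a *: y) = a * dot x y.
Proof. by rewrite /dot -scalemxAr mxE. Qed.

Lemma dotDl x y z : dot (x + y) z = dot x z + dot y z.
Proof. by rewrite ![dot _ z]dotC dotDr. Qed.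

Lemma dotZl a x y : dot (a *: x) y = a * dot x y.
Proof. by rewrite ![dot _ y]dotC dotZr. Qed.

Lemma dotBr x y z : dot x (y - z) = dot x y - dot x z.
Proof. by rewrite dotDr -scaleN1r dotZr mulN1r. Qed.

Lemma dotBl x y z : dot (x - y) z = dot x z - dot y z.
Proof. by rewrite ![dot _ z]dotC dotBr. Qed.

Lemma dot_sumr (I : Type) (r : seq I) (P : pred I) x (F : I -> 'cV[R]_N) :
  dot x (\sum_(i <- r | P i) F i) = \sum_(i <- r | P i) dot x (F i).
Proof. by rewrite /dot mulmx_sumr summxE. Qed.

Lemma dot_mulmx_sym W x y : W^T = W -> dot x (W *m y) = dot (W *m x) y.
Proof. by move=> sW; rewrite /dot trmx_mul sW mulmxA. Qed.

Lemma dot_delta l x : dot (delta_mx l 0) x = x l 0.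
Proof. by rewrite /dot trmx_delta -rowE mxE. Qed.

Lemma dot_ge0 x : 0 <= dot x x.
Proof. by rewrite dotE sumr_ge0// => i _; rewrite -expr2 sqr_ge0. Qed.

Lemma dot_eq0 x : dot x x = 0 -> x = 0.
Proof.
move/eqP; rewrite dotE psumr_eq0 => [/allP h|i _]; last by rewrite -expr2 sqr_ge0.
apply/colP => i; have := h i (mem_index_enum i).
by rewrite /= mxE -expr2 sqrf_eq0 => /eqP.
Qed.

Lemma nrm_ge0 x : 0 <= nrm x. Proof. exact: sqrtr_ge0. Qed.

Lemma sqr_nrm x : nrm x ^+ 2 = dot x x.
Proof. by rewrite sqr_sqrtr ?dot_ge0. Qed.

Lemma nrm_eq0 x : nrm x = 0 -> x = 0.
Proof. by move=> x0; apply: dot_eq0; rewrite -sqr_nrm x0 expr0n. Qed.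

Lemma nrmZ a x : nrm (a *: x) = `|a| * nrm x.
Proof. by rewrite /nrm dotZl dotZr mulrA -expr2 sqrtrM ?sqr_ge0// sqrtr_sqr. Qed.

Lemma nrmN x : nrm (- x) = nrm x.
Proof. by rewrite -scaleN1r nrmZ normrN1 mul1r. Qed.

Lemma nrm0 : nrm (0 : 'cV[R]_N) = 0.
Proof. by rewrite -[0 in LHS](scale0r 0) nrmZ normr0 mul0r. Qed.

Lemma cauchy_schwarz x y : `|dot x y| <= nrm x * nrm y.
Proof.
wlog: x / 0 <= dot x y => [h|d0].
  have [/h//|/ltW dn] := leP 0 (dot x y).
  have : 0 <= dot (- x) y by rewrite -scaleN1r dotZl mulN1r oppr_ge0.
  by move=> /h; rewrite nrmN -scaleN1r dotZl mulN1r normrN.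
rewrite ger0_norm//; have [x0|x0] := eqVneq (nrm x) 0.
  by rewrite (nrm_eq0 x0) nrm0 mul0r dotE big1// => i _; rewrite mxE mul0r.
have [y0|y0] := eqVneq (nrm y) 0.
  by rewrite (nrm_eq0 y0) nrm0 mulr0 dotE big1// => i _; rewrite mxE mulr0.
have p : 0 < nrm x * nrm y by rewrite mulr_gt0// lt_neqAle eq_sym nrm_ge0 ?x0 ?y0.
rewrite -(ler_pM2l p).
have := dot_ge0 (nrm y *: x - nrm x *: y).
rewrite dotBl !dotBr !dotZl !dotZr (dotC y x) -!sqr_nrm.
by move: (nrm x) (nrm y) (dot x y) => a b c; nra.
Qed.

Lemma nrmD x y : nrm (x + y) <= nrm x + nrm y.
Proof.
rewrite -(@ler_pXn2r _ 2) ?nnegrE ?addr_ge0 ?nrm_ge0//.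
rewrite sqr_nrm dotDl !dotDr (dotC y x) -!sqr_nrm.
have := cauchy_schwarz x y; have := ler_norm (dot x y).
by move: (nrm x) (nrm y) (dot x y) `|dot x y| => a b c d; nra.
Qed.

Lemma nrmB x y : nrm (x - y) <= nrm x + nrm y.
Proof. by rewrite (le_trans (nrmD _ _))// nrmN. Qed.

Lemma nrm_sum (I : Type) (r : seq I) (P : pred I) (F : I -> 'cV[R]_N) :
  nrm (\sum_(i <- r | P i) F i) <= \sum_(i <- r | P i) nrm (F i).
Proof.
elim/big_rec2: _ => [|i y z _ h]; first by rewrite nrm0.
by rewrite (le_trans (nrmD _ _))// lerD2l.
Qed.

Lemma coord_le_nrm x l : `|x l 0| <= nrm x.
Proof.
have dl : nrm (delta_mx l 0 : 'cV[R]_N) = 1.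
  by rewrite /nrm dot_delta mxE !eqxx sqrtr1.
by rewrite -dot_delta (le_trans (cauchy_schwarz _ _))// dl mul1r.
Qed.

Lemma nrm_le_coord x (c : R) : (forall l, `|x l 0| <= c) ->
  nrm x ^+ 2 <= N%:R * c ^+ 2.
Proof.
move=> h; rewrite sqr_nrm dotE.
apply: (@le_trans _ _ (\sum_(i < N) c ^+ 2)); last first.
  by rewrite sumr_const card_ord mulr_natl.
apply: ler_sum => i _; rewrite -expr2 -real_normK ?num_real//.
by rewrite ler_pXn2r ?nnegrE// (le_trans _ (h i)).
Qed.

(** The ratios of consecutive terms are nondecreasing, so each is at least [a 1 / a 0]; the product
    form avoids dividing by terms that may vanish. *)
Lemma log_convex_pow (a : nat -> R) :
  (forall n, 0 <= a n) -> (forall n, a n.+1 ^+ 2 <= a n * a n.+2) ->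
  forall n, a 1%N ^+ n.+1 <= a 0%N ^+ n * a n.+1.
Proof.
move=> a0 h.
have step n : a n * a 1%N <= a 0%N * a n.+1.
  elim: n => // n IH; have [z|z] := eqVneq (a n.+1) 0.
    by rewrite z mul0r mulr_ge0.
  have p : 0 < a n.+1 by rewrite lt_neqAle eq_sym z a0.
  rewrite -(ler_pM2l p); have := h n.
  move: IH p (a0 1%N) (a0 n.+2) (a0 n) (a0 0%N).
  move: (a n) (a n.+1) (a n.+2) (a 1%N) (a 0%N) => x y z1 u v *.
  apply: (@le_trans _ _ ((x * z1) * u)); first by nra.
  by nra.
elim=> [|n IH]; first by rewrite expr0 mul1r expr1.
rewrite exprSr (le_trans (ler_wpM2r (a0 1%N) IH))// -mulrA exprSr -mulrA.
by rewrite ler_wpM2l ?exprn_ge0.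
Qed.

Lemma iter_mx_sym W n x y : W^T = W ->
  dot x (iter_mx W n y) = dot (iter_mx W n x) y.
Proof.
move=> sW; elim: n x y => // n IH x y.
by rewrite /iter_mx iterS dot_mulmx_sym// -/(iter_mx W n y) IH /iter_mx -iterSr.
Qed.

Lemma iter_mx_add W m n x : iter_mx W (m + n) x = iter_mx W m (iter_mx W n x).
Proof. exact: iterD. Qed.

(* [W^(2p)] has diagonal entries [|W^p delta_l|^2]; log-convexity of [n |-> |W^n x|]
   turns a bound on [W^p] into one on [W]. *)
Lemma opnorm_of_diag W (kappa : R) p :
  W^T = W -> 0 <= kappa -> (0 < p)%N ->
  (forall l, N%:R * iter_mx W (p + p) (delta_mx l 0) l 0 <= kappa ^+ (p + p)) ->
  forall x, nrm (W *m x) <= kappa * nrm x.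
Proof.
move=> sW k0 p0 h x.
have swap n y z := iter_mx_sym n y z sW.
have Wp y : nrm (iter_mx W p y) <= kappa ^+ p * nrm y.
  have [N0|N0] := posnP N.
    have -> : y = 0 by apply/colP => l; have := ltn_ord l; rewrite [X in (_ < X)%N]N0.
    rewrite (_ : iter_mx _ _ _ = 0) ?nrm0 ?mulr0// /iter_mx.
    by elim: (p) => //= n ->; rewrite mulmx0.
  rewrite -(@ler_pXn2r _ 2) ?nnegrE ?mulr_ge0 ?exprn_ge0 ?nrm_ge0//.
  have N1 : 0 < N%:R :> R by rewrite ltr0n.
  (* By symmetry the entry is the inner product of [W^p delta_l] with [y], and [|W^p delta_l|^2] is
     a diagonal entry of [W^(2p)], at most [kappa^(2p) / N]. Summing the squares over the [N]
     entries removes the [N]. *)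
  have cl l : `|iter_mx W p y l 0| <=
      kappa ^+ p / Num.sqrt N%:R * nrm y.
    rewrite -dot_delta swap (le_trans (cauchy_schwarz _ _))// ler_wpM2r ?nrm_ge0//.
    rewrite -(@ler_pXn2r _ 2) ?nnegrE ?divr_ge0 ?exprn_ge0 ?nrm_ge0 ?sqrtr_ge0//.
    rewrite sqr_nrm -swap -iter_mx_add dot_delta expr_div_n sqr_sqrtr ?ler0n//.
    by rewrite ler_pdivlMr// mulrC -exprM muln2 -addnn h.
  apply: (le_trans (nrm_le_coord cl)).
  rewrite !exprMn exprVn sqr_sqrtr ?ler0n// mulrA.
  by rewrite (mulrCA N%:R) divff ?gt_eqF// mulr1.
pose a n := nrm (iter_mx W n x).
have a2 n : a n.+1 ^+ 2 <= a n * a n.+2.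
  rewrite /a /iter_mx !iterS; move: (iter n _ _) => y.
  rewrite sqr_nrm -dot_mulmx_sym// (le_trans (ler_norm _))//.
  exact: cauchy_schwarz.
have [x0|x0] := eqVneq (nrm x) 0.
  by rewrite (nrm_eq0 x0) mulmx0 nrm0 mulr0.
have xp : 0 < nrm x by rewrite lt_neqAle eq_sym x0 nrm_ge0.
rewrite -(@ler_pXn2r _ p) ?nnegrE ?mulr_ge0 ?nrm_ge0//.
have := log_convex_pow (fun n => nrm_ge0 _) a2 p.-1.
rewrite prednK// => /le_trans; apply.
rewrite (le_trans (ler_wpM2l _ (Wp x))) ?exprn_ge0 ?nrm_ge0//.
by rewrite mulrCA exprMn -exprSr prednK.
Qed.

End Euclidean.


(** * Eigenvectors of a perturbation of orthonormal spikes *)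

Lemma sqr_near1 (R : realType) (x eps : R) : 0 <= eps -> eps <= 1 -> 0 <= x ->
  `|x ^+ 2 - 1| <= eps -> 1 - eps <= x <= 1 + eps.
Proof.
move=> e0 e1 x0; rewrite ler_distl => /andP[h1 h2].
by apply/andP; split; nra.
Qed.

(** An increasing enumeration of an initial segment cannot skip an index. This turns a matching of
    spikes with large eigenvalues into an equality of ranks. *)
Lemma downclosed_increasing_id (k N : nat) (tau : 'I_k -> 'I_N) :
  (forall i j : 'I_k, (i < j)%N -> (tau i < tau j)%N) ->
  (forall (i : 'I_k) (s : 'I_N), (s < tau i)%N -> exists j, s = tau j) ->
  forall i, tau i = i :> nat.
Proof.
move=> mono down i; move: {2}(val i) (leqnn i) => n.
elim: n i => [|n IH] i ilen.
  apply/eqP; move: ilen; rewrite leqn0 => /eqP i0; rewrite i0 -leqn0 leqNgt.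
  apply/negP => t0; have [j jE] := down i (Ordinal (ltn_trans t0 (ltn_ord _))) t0.
  have [j0|j0] := posnP j; last first.
    by have := mono i j; rewrite i0 -jE => /(_ j0); rewrite ltnNge ltnW.
  have ji : j = i by apply/val_inj; rewrite /= j0 i0.
  by have := t0; rewrite -{1}ji -jE /= ltnn.
have [ltin|] := ltnP i n.+1; first exact: IH.
move=> nlei; have {ilen nlei} iE : i = n.+1 :> nat by apply/eqP; rewrite eqn_leq ilen.
have nk : (n < k)%N by rewrite ltnW// -iE.
have n_lt : (n < tau i)%N.
  by rewrite -[n in (n < _)%N](IH (Ordinal nk))//; apply: mono; rewrite iE /=.
apply/eqP; rewrite iE eqn_leq n_lt andbT leqNgt; apply/negP => lt_i.
have [j jE] := down i (Ordinal (ltn_trans lt_i (ltn_ord _))) lt_i.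
have jn : tau j = n.+1 :> nat by rewrite -jE.
have [ji|ji|ji] := ltngtP j i.
- have jlen : (j <= n)%N by rewrite -ltnS -iE.
  by have := jlen; rewrite -(IH j jlen) jn ltnn.
- by have := mono _ _ ji; rewrite jn ltnNge ltnW.
- by have := lt_i; rewrite -{1}(val_inj ji) jn ltnn.
Qed.

Lemma iter_mxD (R : realType) N (W : 'M[R]_N) n x y :
  iter_mx W n (x + y) = iter_mx W n x + iter_mx W n y.
Proof. by rewrite /iter_mx; elim: n => //= n ->; rewrite mulmxDr. Qed.

Lemma iter_mxZ (R : realType) N (W : 'M[R]_N) n a x :
  iter_mx W n (a *: x) = a *: iter_mx W n x.
Proof. by rewrite /iter_mx; elim: n => //= n ->; rewrite scalemxAr. Qed.

Lemma iter_mx_sum (R : realType) N k (W : 'M[R]_N) n (F : 'I_k -> 'cV[R]_N) :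
  iter_mx W n (\sum_j F j) = \sum_j iter_mx W n (F j).
Proof. by rewrite /iter_mx; elim: n => //= n ->; rewrite mulmx_sumr. Qed.

Lemma geometric_sum_le (R : realType) (x : R) n :
  0 <= x -> 2 * x <= 1 -> \sum_(i < n) x ^+ i.+1 <= 2 * x.
Proof.
move=> x0 x1; elim: n => [|n IH]; first by rewrite big_ord0 mulr_ge0.
rewrite big_ord_recl expr1; under eq_bigr do rewrite exprS.
by rewrite -mulr_sumr; move: (\sum_(i < n) _) IH => s IH; nra.
Qed.

Section SpikedEigenvectors.
Context {R : realType} {N k : nat}.
Variables (w : 'M[R]_N) (e : 'I_k -> 'cV[R]_N) (alpha : 'I_k -> R).
Variables (eps a0 r S : R).
(** [c] bounds from below every eigenvalue near a spike, [D * eps] bounds the overlap of an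
    eigenvector with a distant spike, and [C2 * eps] its distance to a multiple of its own spike.
    Here [r] is a radius for which the intervals around the [alpha i] are disjoint. *)
Let c := a0 / 2.
Let D := (2 + 2 * S) / r.
Let C2 := (1 + 2 * S * D) / c.

(** The action of [A / theta], where [w] stands for [W / theta]. *)
Definition spiked_op (x : 'cV[R]_N) : 'cV[R]_N :=
  w *m x + \sum_j (alpha j * dot (e j) x) *: e j.

Hypotheses (sw : w^T = w) (wle : forall x, nrm (w *m x) <= eps * nrm x).
Hypothesis ee : forall i j, `|dot (e i) (e j) - (i == j)%:R| <= eps.
Hypotheses (a0_gt0 : 0 < a0) (a0_le : forall i, a0 <= alpha i).
Hypotheses (r_gt0 : 0 < r) (r_le : 4 * r <= a0).
Hypothesis alpha_sep : forall i j, i != j -> 2 * r <= `|alpha i - alpha j|.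
Hypothesis alpha_sum : \sum_i alpha i <= S.
Hypotheses (eps_ge0 : 0 <= eps) (eps_le : 4 * eps <= 1).
Hypotheses (D_eps : 4 * (D * eps) <= 1) (C2_eps : 8 * (C2 * eps) <= 1).

Let c_gt0 : 0 < c. Proof. by rewrite divr_gt0. Qed.

Let alpha_ge0 i : 0 <= alpha i.
Proof. exact/ltW/(lt_le_trans a0_gt0). Qed.

Let S_ge0 : 0 <= S.
Proof. by apply: le_trans alpha_sum; apply: sumr_ge0. Qed.

Let D_ge0 : 0 <= D.
Proof. by rewrite divr_ge0 ?(ltW r_gt0)// addr_ge0// mulr_ge0. Qed.

Let C2_ge0 : 0 <= C2.
Proof. by rewrite divr_ge0 ?(ltW c_gt0)// addr_ge0// mulr_ge0// mulr_ge0. Qed.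

Let C2_c : C2 * eps * c = (1 + 2 * S * D) * eps.
Proof. by rewrite /C2 mulrAC divfK ?gt_eqF. Qed.

Let nrm_e_bound i : 1 - eps <= nrm (e i) <= 1 + eps.
Proof.
have := ee i i; rewrite eqxx -sqr_nrm; apply: sqr_near1 => //.
  by move: eps_le; lra.
exact: nrm_ge0.
Qed.

Let nrm_e_le2 i : nrm (e i) <= 2.
Proof. by have /andP[_] := nrm_e_bound i; move: eps_le; lra. Qed.

Let weighted_sum (b : R) (F : 'I_k -> R) (Q : pred 'I_k) : 0 <= b ->
  (forall j, Q j -> `|F j| <= b) -> \sum_(j | Q j) alpha j * `|F j| <= S * b.
Proof.
move=> b0 h; apply: (@le_trans _ _ ((\sum_j alpha j) * b)); last exact: ler_wpM2r.
rewrite mulr_suml [leRHS](bigID Q) /= -[leLHS]addr0 lerD//; last first.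
  by apply: sumr_ge0 => j _; exact: mulr_ge0.
by apply: ler_sum => j Qj; rewrite ler_wpM2l// h.
Qed.

Section OneEigenvector.
Variables (mu : R) (v : 'cV[R]_N).
Hypotheses (v1 : nrm v = 1) (vmu : spiked_op v = mu *: v).

Lemma dot_e_le2 j : `|dot (e j) v| <= 2.
Proof. by rewrite (le_trans (cauchy_schwarz _ _))// v1 mulr1. Qed.

(** Pairing the eigenvector equation with [e m] leaves on the other side only the noise term and the
    defect of orthonormality of the spikes, both of order [eps]. *)
Lemma spike_overlap m : `|(mu - alpha m) * dot (e m) v| <= (2 + 2 * S) * eps.
Proof.
have -> : (mu - alpha m) * dot (e m) v = dot (e m) (w *m v) +
    \sum_j alpha j * (dot (e j) v * (dot (e m) (e j) - (m == j)%:R)).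
  rewrite mulrBl -dotZr -vmu /spiked_op dotDr dot_sumr -addrA; congr (_ + _).
  have -> : alpha m * dot (e m) v = \sum_j alpha j * dot (e j) v * (m == j)%:R.
    rewrite (bigD1 m)//= eqxx mulr1 big1 ?addr0// => j jm.
    by rewrite eq_sym (negbTE jm) mulr0.
  rewrite -sumrB; apply: eq_bigr => j _; rewrite dotZr; ring.
rewrite (le_trans (ler_normD _ _))// mulrDl lerD//.
  rewrite (le_trans (cauchy_schwarz _ _))//.
  by rewrite ler_pM ?nrm_ge0// (le_trans (wle v))// v1 mulr1.
rewrite (le_trans (ler_norm_sum _ _ _))//.
rewrite (mulrC 2) -mulrA.
under eq_bigr do rewrite normrM (ger0_norm (alpha_ge0 _)).
apply: weighted_sum => [|j _]; first by rewrite mulr_ge0.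
by rewrite normrM ler_pM// dot_e_le2.
Qed.

Lemma far_spike_overlap m : r <= `|mu - alpha m| -> `|dot (e m) v| <= D * eps.
Proof.
move=> h; rewrite /D -mulrA (mulrC r^-1) mulrA ler_pdivlMr//.
apply: le_trans (spike_overlap m); rewrite normrM mulrC.
by rewrite ler_wpM2r.
Qed.

(** [Q] selects spikes far from [mu], whose overlaps are [O(eps)]: their terms join the noise in the
    error. It is applied with all spikes in [Q], and with all but one. *)
Lemma eigenvector_nrm_bound (Q : pred 'I_k) :
  (forall m, Q m -> r <= `|mu - alpha m|) ->
  nrm (mu *: v - \sum_(j | ~~ Q j) (alpha j * dot (e j) v) *: e j) <=
    (1 + 2 * S * D) * eps.
Proof.
move=> h; rewrite -vmu /spiked_op [X in _ + X - _](bigID Q) /= addrA addrK.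
rewrite (le_trans (nrmD _ _))// mulrDl mul1r lerD//.
  by rewrite (le_trans (wle v))// v1 mulr1.
rewrite (le_trans (nrm_sum _ _ _))//.
under eq_bigr do rewrite nrmZ -(ger0_norm (nrm_ge0 _)) -normrM -mulrA normrM
  (ger0_norm (alpha_ge0 _)).
have -> : 2 * S * D * eps = S * (2 * (D * eps)) by move: (D) => D'; ring.
apply: weighted_sum => [|j Qj].
  by apply: mulr_ge0 => //; exact: mulr_ge0.
rewrite normrM mulrC ler_pM//; first by rewrite ger0_norm ?nrm_ge0.
exact/far_spike_overlap/h.
Qed.

(** If every spike were far, [mu *: v] itself would be an error term, of norm at most
    [C2 * eps * c <= c / 8], although [v] is a unit vector. *)
Lemma near_spike : c <= mu -> exists m, `|mu - alpha m| < r.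
Proof.
move=> cmu; apply: contrapT => /forallNP h.
have /eigenvector_nrm_bound : forall m, xpredT m -> r <= `|mu - alpha m|.
  by move=> m _; rewrite leNgt; apply/negP/h.
rewrite big_pred0// subr0 nrmZ v1 mulr1.
 rewrite ger0_norm; last exact: (le_trans (ltW c_gt0) cmu).
move=> /(le_trans cmu); rewrite -C2_c; move: C2_eps c_gt0.
by move: (C2 * eps) (c) => x y *; nra.
Qed.

Variable m : 'I_k.
Hypothesis mu_near : `|mu - alpha m| < r.

Lemma near_mu_ge : c <= mu.
Proof.
have := mu_near; have := a0_le m; rewrite ltr_distl => h1 /andP[h2 h3].
by move: r_le a0_gt0; rewrite /c; lra.
Qed.

Lemma other_spike_overlap j : j != m -> `|dot (e j) v| <= D * eps.
Proof.
move=> jm; apply: far_spike_overlap; have := alpha_sep jm.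
have := ler_distD mu (alpha j) (alpha m); rewrite (distrC (alpha j) mu).
by have := mu_near; lra.
Qed.

(** The coefficient of [e m] once the eigenvector equation is divided by [mu]. It is preferred to
    the overlap [dot (e m) v] because it is the one occurring in the order zero term of the
    expansion. *)
Definition spike_coef := alpha m * dot (e m) v / mu.

Lemma eigenvector_near_spike : nrm (v - spike_coef *: e m) <= C2 * eps.
Proof.
have mu_gt0 : 0 < mu := lt_le_trans c_gt0 near_mu_ge.
have /eigenvector_nrm_bound : forall j, j != m -> r <= `|mu - alpha j|.
  move=> j jm; have := alpha_sep jm.
  have := ler_distD mu (alpha j) (alpha m); rewrite (distrC (alpha j) mu).
  by have := mu_near; lra.
rewrite (big_pred1 m) => [|j]; last by rewrite /= negbK.
have -> : mu *: v - (alpha m * dot (e m) v) *: e m = mu *: (v - spike_coef *: e m).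
  by rewrite scalerBr scalerA /spike_coef (mulrC mu) divfK ?gt_eqF.
rewrite nrmZ gtr0_norm// => near; rewrite -(ler_pM2r c_gt0) C2_c (le_trans _ near)//.
by rewrite mulrC ler_wpM2r ?nrm_ge0// near_mu_ge.
Qed.

(** Both [v] and [e m] have norm [1 + O(eps)] and [v] is within [C2 * eps] of [spike_coef *: e m],
    so the coefficient has modulus near 1; the sign condition excludes -1. *)
Lemma spike_coef_near1 : 0 <= dot (e m) v -> `|spike_coef - 1| <= (C2 + 2) * eps.
Proof.
move=> d0; have mu_gt0 : 0 < mu := lt_le_trans c_gt0 near_mu_ge.
have c0 : 0 <= spike_coef by rewrite divr_ge0 ?(ltW mu_gt0)// mulr_ge0.
have h := eigenvector_near_spike.
have h1 : nrm v <= nrm (v - spike_coef *: e m) + nrm (spike_coef *: e m).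
  by rewrite -{1}[v](subrK (spike_coef *: e m)) nrmD.
have h2 : nrm (spike_coef *: e m) <= nrm v + nrm (v - spike_coef *: e m).
  by rewrite -{1}[spike_coef *: e m](subKr v) nrmB.
have /andP[e1 e2] := nrm_e_bound m.
move: h1 h2 h; rewrite v1 nrmZ (ger0_norm c0) => h1 h2 h.
have h3 : spike_coef * nrm (e m) <= 9 / 8 by move: C2_eps h2 h; lra.
move: eps_ge0 eps_le c0 h1 h2 h h3 e1 e2.
move: (nrm (v - spike_coef *: e m)) (nrm (e m)) spike_coef (C2) => x y z u *.
have h4 : z <= 2 by nra.
by rewrite ler_distl; apply/andP; split; nra.
Qed.

End OneEigenvector.

(** Both eigenvectors are within 1/8 of the line of [e m]. Their approximations on that line have
    inner product at least [(7/8)^2] in modulus, whereas orthogonality would force at most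
    [1/8 + 1/8 + 1/64]. *)
Lemma spike_multiplicity1 mu mu' v v' m :
  nrm v = 1 -> nrm v' = 1 -> spiked_op v = mu *: v -> spiked_op v' = mu' *: v' ->
  `|mu - alpha m| < r -> `|mu' - alpha m| < r -> dot v v' != 0.
Proof.
move=> v1 v1' vmu vmu' h h'; apply/eqP => vv.
have := eigenvector_near_spike v1 vmu h.
have := eigenvector_near_spike v1' vmu' h'.
move: (spike_coef mu v m) (spike_coef mu' v' m) => x x' b' b.
have [rho rhoE] : exists y, y = v - x *: e m by eexists.
have [rho' rhoE'] : exists y, y = v' - x' *: e m by eexists.
rewrite -rhoE in b; rewrite -rhoE' in b'.
have vE : x *: e m = v - rho by rewrite rhoE subKr.
have vE' : x' *: e m = v' - rho' by rewrite rhoE' subKr.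
have n1 : 1 - nrm rho <= nrm (x *: e m).
  by rewrite lerBlDr -v1 -{1}[v](subrK rho) vE nrmD.
have n1' : 1 - nrm rho' <= nrm (x' *: e m).
  by rewrite lerBlDr -v1' -{1}[v'](subrK rho') vE' nrmD.
have dE : `|dot (x *: e m) (x' *: e m)| = nrm (x *: e m) * nrm (x' *: e m).
  rewrite dotZl dotZr !nrmZ !normrM (ger0_norm (dot_ge0 _)) -sqr_nrm; ring.
have : `|dot (x *: e m) (x' *: e m)| <= nrm rho + nrm rho' + nrm rho * nrm rho'.
  rewrite vE vE' dotBl !dotBr vv sub0r.
  have := cauchy_schwarz v rho'; have := cauchy_schwarz rho v'.
  have := cauchy_schwarz rho rho'; rewrite v1 v1' mul1r mulr1.
  by rewrite !ler_norml => /andP[? ?] /andP[? ?] /andP[? ?]; apply/andP; split; lra.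
rewrite dE; have := C2_eps; have := nrm_ge0 rho; have := nrm_ge0 rho'.
move: (C2 * eps) b b' n1 n1' => t.
move: (nrm (x *: e m)) (nrm (x' *: e m)) (nrm rho) (nrm rho') => p q u u' *.
have : (7 / 8) * (7 / 8) <= p * q by apply: ler_pM; lra.
have : u * u' <= (1 / 8) * (1 / 8) by apply: ler_pM; lra.
by lra.
Qed.

Variables (q : 'I_N -> 'cV[R]_N) (lam : 'I_N -> R).
Hypotheses (q_eigen : forall t, spiked_op (q t) = lam t *: q t).
Hypothesis q_ortho : forall s t, dot (q s) (q t) = (s == t)%:R.
Hypothesis lam_anti : forall s t : 'I_N, (s <= t)%N -> lam t <= lam s.

Let nrm_q t : nrm (q t) = 1.
Proof. by rewrite /nrm q_ortho eqxx sqrtr1. Qed.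

Lemma parseval x : dot x x = \sum_t dot (q t) x ^+ 2.
Proof.
pose Q := \matrix_(i, j) q i j 0.
have QQ : Q *m Q^T = 1%:M.
  apply/matrixP => s t; rewrite !mxE -q_ortho dotE.
  by apply: eq_bigr => i _; rewrite !mxE.
have -> : dot x x = dot (Q *m x) (Q *m x).
  by rewrite /dot trmx_mul mulmxA -[_ *m Q^T *m Q]mulmxA (mulmx1C QQ) mulmx1.
rewrite dotE; apply: eq_bigr => t _; rewrite expr2.
suff -> : (Q *m x) t 0 = dot (q t) x by [].
by rewrite mxE dotE; apply: eq_bigr => i _; rewrite mxE.
Qed.

Lemma spiked_op_sym x y : dot x (spiked_op y) = dot (spiked_op x) y.
Proof.
rewrite /spiked_op dotDr (dotC (_ + _)) dotDr; congr (_ + _).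
  by rewrite [LHS]dotC [RHS]dot_mulmx_sym.
rewrite !dot_sumr; apply: eq_bigr => j _; rewrite !dotZr (dotC x) (dotC y); ring.
Qed.

(** [e m] is an approximate eigenvector: if no eigenvalue were within [r] of [alpha m], Parseval
    would bound the residual below by [r * nrm (e m)], while it is at most [(2 + 2 * S) * eps], that
    is [r * (D * eps) <= r / 4]. *)
Lemma spike_eigenvalue m : exists t, `|lam t - alpha m| < r.
Proof.
apply: contrapT => /forallNP h.
have yE : spiked_op (e m) - alpha m *: e m = w *m e m +
    \sum_j (alpha j * (dot (e j) (e m) - (j == m)%:R)) *: e j.
  have -> : alpha m *: e m = \sum_j (alpha j * (j == m)%:R) *: e j.
    rewrite (bigD1 m)//= eqxx mulr1 big1 ?addr0// => j /negbTE ->.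
    by rewrite mulr0 scale0r.
  rewrite /spiked_op -addrA -sumrB; congr (_ + _); apply: eq_bigr => j _.
  by rewrite -scalerBl mulrBr.
have up : nrm (spiked_op (e m) - alpha m *: e m) <= (2 + 2 * S) * eps.
  rewrite yE (le_trans (nrmD _ _))// mulrDl lerD//.
    by rewrite (le_trans (wle _))// mulrC ler_wpM2r.
  rewrite (le_trans (nrm_sum _ _ _))//.
  under eq_bigr do rewrite nrmZ -(ger0_norm (nrm_ge0 _)) -normrM -mulrA normrM
    (ger0_norm (alpha_ge0 _)).
  rewrite (mulrC 2) -mulrA (mulrC 2); apply: weighted_sum => [|j _].
    by rewrite mulr_ge0.
  by rewrite normrM ler_pM// ger0_norm ?nrm_ge0.
have low : (r * nrm (e m)) ^+ 2 <= nrm (spiked_op (e m) - alpha m *: e m) ^+ 2.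
  rewrite exprMn !sqr_nrm !parseval mulr_sumr; apply: ler_sum => t _.
  rewrite dotBr spiked_op_sym q_eigen dotZl dotZr -mulrBl exprMn.
  rewrite ler_wpM2r ?sqr_ge0// -[leRHS]real_normK ?num_real//.
  by rewrite ler_pXn2r ?nnegrE ?(ltW r_gt0)// leNgt; apply/negP/h.
have : r * nrm (e m) <= (2 + 2 * S) * eps.
  apply: le_trans up; rewrite -(@ler_pXn2r _ 2) ?nnegrE ?nrm_ge0//.
  by rewrite mulr_ge0 ?nrm_ge0 ?(ltW r_gt0).
have := D_eps; rewrite /D mulrAC mulrA ler_pdivrMr// mul1r.
have /andP[] := nrm_e_bound m.
move: eps_le r_gt0; clear yE up low.
by move: (nrm _) ((2 + 2 * S) * eps) => x y *; nra.
Qed.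

Hypothesis alpha_anti : forall i j : 'I_k, (i < j)%N -> alpha j < alpha i.

(** [tau] chooses for each spike an eigenvalue near it. Separation of the spikes makes it strictly
    increasing. Each eigenvalue at least [c] lies near some spike and, by [spike_multiplicity1], is
    then the chosen one; so the image is an initial segment of the indices. *)
Lemma nth_eigenvalue_near_spike (i : 'I_k) (t : 'I_N) :
  i = t :> nat -> `|lam t - alpha i| < r.
Proof.
pose tau m := projT1 (cid (spike_eigenvalue m)).
have tauP m : `|lam (tau m) - alpha m| < r by rewrite /tau; case: cid.
have tauc m : c <= lam (tau m).
  by apply: near_mu_ge (tauP m).
have tau_mono (m m' : 'I_k) : (m < m')%N -> (tau m < tau m')%N.
  move=> mm; rewrite ltnNge; apply/negP => /lam_anti.
  have := alpha_anti mm; have := @alpha_sep m m'.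
  rewrite -val_eqE ltn_eqF// => /(_ isT); have := tauP m; have := tauP m'.
  rewrite !ltr_distl => /andP[? ?] /andP[? ?] + ?.
  by rewrite ger0_norm; lra.
have tau_onto s : c <= lam s -> exists m, s = tau m.
  move=> /near_spike - /(_ _ (nrm_q s) (q_eigen s))[m sm]; exists m.
  apply/eqP; have := spike_multiplicity1 (nrm_q s) (nrm_q (tau m)) (q_eigen _)
    (q_eigen _) sm (tauP m).
  by rewrite q_ortho; case: (s == _); rewrite ?eqxx.
have tau_id := downclosed_increasing_id tau_mono.
move=> it; have <- : tau i = t.
  apply/val_inj; rewrite /= -it tau_id// => j s sj.
  by apply: tau_onto; rewrite (le_trans (tauc j))// lam_anti// ltnW.
exact: tauP.
Qed.

Variables (mu : R) (v : 'cV[R]_N) (m : 'I_k) (eta H : R) (n0 : nat).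
Hypotheses (v1 : nrm v = 1) (vmu : spiked_op v = mu *: v).
Hypotheses (mu_near : `|mu - alpha m| < r) (v_sign : 0 <= dot (e m) v).
Hypotheses (eta_ge0 : 0 <= eta) (H_ge0 : 0 <= H) (eps_c : 2 * eps <= c).
Hypothesis e_sup : forall j l, `|e j l 0| <= H * eta.
Hypothesis walk_sup : forall j n l, (0 < n <= n0)%N ->
  `|iter_mx w n (e j) l 0| <= eta * eps ^+ n.
Hypothesis tail : (eps / c) ^+ n0.+1 <= eta * eps.

(** The eigenvector equation is substituted repeatedly into its own noise term [w *m v]; the spike
    part is not iterated, so [w] is only ever applied to the fixed [e j], except in the
    remainder. *)
Lemma spiked_eigenvector_expansion n :
  v = \sum_(i < n) mu ^- i.+1 *:
        (\sum_j (alpha j * dot (e j) v) *: iter_mx w i (e j)) +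
      mu ^- n *: iter_mx w n v.
Proof.
have mu0 : mu != 0 by rewrite gt_eqF// (lt_le_trans c_gt0)// (near_mu_ge mu_near).
elim: n => [|n IH]; first by rewrite big_ord0 add0r invr1 scale1r.
rewrite big_ord_recr /= -addrA {1}IH; congr (_ + _).
transitivity (mu ^- n *: (mu^-1 *: iter_mx w n (spiked_op v))).
  by rewrite vmu iter_mxZ (scalerA mu^-1) mulVf// scale1r.
rewrite scalerA -invfM -exprSr -scalerDr; congr (_ *: _).
rewrite /spiked_op iter_mxD addrC; congr (_ + _).
  by rewrite iter_mx_sum; apply: eq_bigr => j _; rewrite iter_mxZ.
by rewrite /iter_mx -iterSr.
Qed.

(** The four constants correspond to the spike [m] at order zero, the other spikes at order zero,
    the orders 1 to [n0], and the remainder. [eta] plays the role of [1 / sqrt N]. *)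
Lemma spiked_eigenvector_sup l : `|(v - e m) l 0| <=
  ((C2 + 2) * H + S * D * H / c + 4 * S / c ^+ 2 + 1) * (eta * eps).
Proof.
have cmu : c <= mu := near_mu_ge mu_near.
have mu_gt0 : 0 < mu := lt_le_trans c_gt0 cmu.
have muV n : `|mu ^- n| <= c ^- n.
  rewrite ger0_norm ?invr_ge0 ?exprn_ge0 ?(ltW mu_gt0)//.
  by rewrite lef_pV2 ?posrE ?exprn_gt0// lerXn2r// nnegrE ltW.
have cV0 : 0 <= c^-1 by rewrite invr_ge0 ltW.
have vE := spiked_eigenvector_expansion n0.+1.
rewrite big_ord_recl /= expr1 (bigD1 m)//= scalerDr scalerA in vE.
have -> : (v - e m) l 0 = (spike_coef mu v m - 1) * e m l 0 +
   mu^-1 * (\sum_(j < k | j != m) alpha j * (dot (e j) v * e j l 0)) +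
   \sum_(i < n0) mu ^- i.+2 *
     (\sum_j alpha j * (dot (e j) v * iter_mx w i.+1 (e j) l 0)) +
   mu ^- n0.+1 * iter_mx w n0.+1 v l 0.
  rewrite mxE [X in _ + X]mxE [v l 0](_ : _ = spike_coef mu v m * e m l 0 +
    mu^-1 * (\sum_(j < k | j != m) alpha j * (dot (e j) v * e j l 0)) +
    \sum_(i < n0) mu ^- i.+2 *
      (\sum_j alpha j * (dot (e j) v * iter_mx w i.+1 (e j) l 0)) +
    mu ^- n0.+1 * iter_mx w n0.+1 v l 0); first ring.
  rewrite [in LHS]vE [LHS]mxE; congr (_ + _); last by rewrite mxE.
  rewrite [LHS]mxE; congr (_ + _); last first.
    rewrite summxE; apply: eq_bigr => i _; rewrite mxE summxE; congr (_ * _).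
    by apply: eq_bigr => j _; rewrite mxE mulrA.
  rewrite [LHS]mxE; congr (_ + _); rewrite mxE; first by rewrite [mu^-1 * _]mulrC.
  by congr (_ * _); rewrite summxE; apply: eq_bigr => j _; rewrite mxE mulrA.
rewrite 3!(mulrDl _ _ (eta * eps)).
apply: (le_trans (ler_normD _ _)); apply: lerD.
  apply: (le_trans (ler_normD _ _)); apply: lerD.
    apply: (le_trans (ler_normD _ _)); apply: lerD.
- have -> : (C2 + 2) * H * (eta * eps) = (C2 + 2) * eps * (H * eta) by ring.
  by rewrite normrM ler_pM// (spike_coef_near1 v1 vmu).
- have -> : S * D * H / c * (eta * eps) = c^-1 * (S * (D * eps * (H * eta))) by ring.
  rewrite normrM ler_pM//; first by have := muV 1%N; rewrite expr1.
  rewrite (le_trans (ler_norm_sum _ _ _))//.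
  under eq_bigr do rewrite normrM (ger0_norm (alpha_ge0 _)).
  apply: weighted_sum => [|j jm]; first by apply: mulr_ge0; exact: mulr_ge0.
  by rewrite normrM ler_pM// (other_spike_overlap v1 vmu mu_near).
(* One factor 2 bounds the overlaps [dot (e j) v]; the other comes from the geometric series, whose
   ratio [eps / c] is at most 1/2. *)
- have -> : 4 * S / c ^+ 2 * (eta * eps) = 2 * S * eta / c * (2 * (eps / c)).
    by field; rewrite gt_eqF.
  apply: (@le_trans _ _ (\sum_(i < n0) 2 * S * eta / c * (eps / c) ^+ i.+1)).
    rewrite (le_trans (ler_norm_sum _ _ _))//; apply: ler_sum => i _.
    have -> : 2 * S * eta / c * (eps / c) ^+ i.+1 =
        c ^- i.+2 * (S * (2 * (eta * eps ^+ i.+1))).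
      by rewrite expr_div_n [c ^+ i.+2]exprS; field; rewrite expf_neq0 gt_eqF.
    rewrite normrM ler_pM// (le_trans (ler_norm_sum _ _ _))//.
    under eq_bigr do rewrite normrM (ger0_norm (alpha_ge0 _)).
    apply: weighted_sum => [|j _]; first by rewrite !mulr_ge0// exprn_ge0.
    by rewrite normrM ler_pM// ?(dot_e_le2 v1)// walk_sup/=.
  rewrite -mulr_sumr ler_wpM2l//; first by rewrite !mulr_ge0.
  by apply: geometric_sum_le; [rewrite mulr_ge0|rewrite mulrA ler_pdivrMr// mul1r].
(* Here an entry is bounded by the whole Euclidean norm; enough iterations, as recorded in [tail],
   make up for the missing factor [eta]. *)
- rewrite mul1r (le_trans _ tail)// expr_div_n mulrC normrM ler_pM//.
  rewrite (le_trans (coord_le_nrm _ _))//.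
  suff h n : nrm (iter_mx w n v) <= eps ^+ n by exact: h.
  elim: n => [|n IH]; first by rewrite /= v1.
  by rewrite exprS (le_trans (wle _))// ler_wpM2l.
Qed.

End SpikedEigenvectors.

(** The witness [(1 + \sum_i (f i)^-1)^-1] replaces a minimum and makes sense for an empty index
    type too. *)
Lemma pos_lower_bound (R : realType) (I : finType) (f : I -> R) :
  (forall i, 0 < f i) -> exists2 a : R, 0 < a & forall i, a <= f i.
Proof.
move=> f0; have S0 : 0 <= \sum_i (f i)^-1 by apply: sumr_ge0 => i _; rewrite invr_ge0 ltW.
exists (1 + \sum_i (f i)^-1)^-1; first by rewrite invr_gt0; lra.
move=> i; rewrite -[leRHS]invrK lef_pV2 ?posrE ?invr_gt0//; last by lra.
rewrite (bigD1 i)//= addrCA lerDl addr_ge0//.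
by apply: sumr_ge0 => j _; rewrite invr_ge0 ltW.
Qed.

Lemma normmx_le (R : realType) N (x : 'cV[R]_N) (c : R) : 0 <= c ->
  (forall l, `|x l 0| <= c) -> `|x| <= c.
Proof.
move=> c0 h; rewrite [leLHS]mx_normrE; apply: bigmax_le => // -[i j] _ /=.
by rewrite (ord1 j).
Qed.

(** The deterministic half in the original scale. The constants are quantified before [N], [W],
    [theta] and [kappa], hence uniform along the sequence. *)
Lemma eigenvector_bound (R : realType) (k : nat) (alpha : 'I_k -> R) (H : R) :
  (0 < k)%N -> (forall i j : 'I_k, (i < j)%N -> alpha j < alpha i) ->
  (forall i, 0 < alpha i) -> 0 <= H ->
  exists (C eps0 c : R), [/\ 0 < C, 0 < eps0, 0 < c &
    forall (N : nat) (W : 'M[R]_N) (e : 'I_k -> 'cV[R]_N) (theta kappa : R) (n0 : nat),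
      W^T = W -> 0 < theta -> 0 <= kappa -> kappa / theta <= eps0 ->
      (forall x, nrm (W *m x) <= kappa * nrm x) ->
      (forall i j, `|dot (e i) (e j) - (i == j)%:R| <= kappa / theta) ->
      (forall j l, `|e j l 0| <= H / Num.sqrt N%:R) ->
      (forall j n l, (0 < n <= n0)%N ->
         `|iter_mx W n (e j) l 0| <= kappa ^+ n / Num.sqrt N%:R) ->
      (kappa / theta / c) ^+ n0.+1 <= (Num.sqrt N%:R)^-1 * (kappa / theta) ->
      let A := W + theta *: \sum_i alpha i *: (e i *m (e i)^T) in
      forall (i : 'I_k) (v : 'cV[R]_N), (i < N)%N ->
        unit_eigenvector A (lambda A i) v -> 0 <= dot (e i) v ->
        `|v - e i| <= C * ((Num.sqrt N%:R)^-1 * (kappa / theta))].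
Proof.
move=> k0 alpha_anti alpha_gt0 H0.
have [a0 a0_gt0 a0_le] := pos_lower_bound alpha_gt0.
(* The value 1 on the diagonal keeps the function positive on all pairs, so that [pos_lower_bound]
   applies. *)
pose gap (p : 'I_k * 'I_k) : R := if p.1 == p.2 then 1 else `|alpha p.1 - alpha p.2|.
have alpha_neq i j : i != j -> 0 < `|alpha i - alpha j|.
  move=> ij; rewrite normr_gt0 subr_eq0.
  case: (ltngtP i j) => [/alpha_anti|/alpha_anti|/val_inj/eqP].
  - by move=> h; rewrite gt_eqF.
  - by move=> h; rewrite lt_eqF.
  - by rewrite (negbTE ij).
have [g0 g0_gt0 g0_le] : exists2 g0 : R, 0 < g0 & forall p, g0 <= gap p.
  apply: pos_lower_bound => -[i j]; rewrite /gap /=; case: eqVneq => // ij.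
  exact: alpha_neq.
(* The first bound keeps eigenvalues near a spike above [a0 / 2]; the second makes the intervals of
   radius [r] around the spikes disjoint. *)
pose r := Num.min (a0 / 4) (g0 / 2).
have r_gt0 : 0 < r by rewrite lt_min !divr_gt0.
have r_le : 4 * r <= a0 by rewrite mulrC -ler_pdivlMr// ge_min lexx.
have sep i j : i != j -> 2 * r <= `|alpha i - alpha j|.
  move=> ij; rewrite mulrC -ler_pdivlMr// ge_min; apply/orP; right.
  by rewrite ler_pM2r// (le_trans (g0_le (i, j)))// /gap /= (negbTE ij).
pose S := \sum_i alpha i.
have S_ge0 : 0 <= S by apply: sumr_ge0 => i _; exact: ltW.
pose c := a0 / 2; pose D := (2 + 2 * S) / r; pose C2 := (1 + 2 * S * D) / c.
have c_gt0 : 0 < c by rewrite divr_gt0.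
have D_gt0 : 0 < D by rewrite divr_gt0// ltr_wpDr// mulr_ge0.
have S2_ge0 : 0 <= 2 * S by rewrite mulr_ge0.
have SD_ge0 : 0 <= 2 * S * D := mulr_ge0 S2_ge0 (ltW D_gt0).
have C2_gt0 : 0 < C2 by rewrite divr_gt0// ltr_wpDr.
pose C := (C2 + 2) * H + S * D * H / c + 4 * S / c ^+ 2 + 1.
have C_gt0 : 0 < C.
  have h1 : 0 <= (C2 + 2) * H by rewrite mulr_ge0// addr_ge0// ltW.
  have h2 : 0 <= S * D * H / c.
    by rewrite (divr_ge0 _ (ltW c_gt0))// (mulr_ge0 _ H0)// (mulr_ge0 S_ge0 (ltW D_gt0)).
  have h3 : 0 <= 4 * S / c ^+ 2.
    by rewrite divr_ge0 ?exprn_ge0 ?(ltW c_gt0)// mulr_ge0.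
  by rewrite /C ltr_wpDl// (addr_ge0 (addr_ge0 h1 h2) h3).
(* The sum of the four coefficients of [eps] in the smallness conditions below: [B0 * eps <= 1]
   yields them all. *)
pose B0 := 4 + 4 * D + 8 * C2 + 2 / c.
have B0_gt0 : 0 < B0.
  have h1 : 0 < 4 * D by rewrite mulr_gt0.
  have h2 : 0 < 8 * C2 by rewrite mulr_gt0.
  have h3 : 0 < 2 / c by rewrite divr_gt0.
  by rewrite /B0 addr_gt0// addr_gt0// addr_gt0.
exists C, B0^-1, c; split; rewrite ?invr_gt0//.
move=> N W e theta kappa n0 sW th0 ka0 eps0 Wle ee esup wsup tail A i v iN [Av v1] vs.
pose eps := kappa / theta; rewrite -/eps in eps0 ee tail *.
have eps_ge0 : 0 <= eps by rewrite divr_ge0// ltW.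
have B0e : B0 * eps <= 1 by rewrite mulrC -ler_pdivlMr// mul1r.
have [e1 e2 e3 e4] : [/\ 4 * eps <= 1, 4 * (D * eps) <= 1,
    8 * (C2 * eps) <= 1 & 2 * eps <= c].
  have cV : 0 < c^-1 by rewrite invr_gt0.
  have De : 0 <= D * eps by rewrite mulr_ge0// ltW.
  have C2e : 0 <= C2 * eps by rewrite mulr_ge0// ltW.
  have ce : 0 <= 2 / c * eps by rewrite (mulr_ge0 _ eps_ge0)// (divr_ge0 _ (ltW c_gt0)).
  have BE : B0 * eps = 4 * eps + 4 * (D * eps) + 8 * (C2 * eps) + 2 / c * eps.
    by rewrite /B0; move: (D) (C2) (c) (eps) => *; ring.
  rewrite BE in B0e.
  have cE : (2 * eps <= c) = (2 / c * eps <= 1).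
    by rewrite mulrAC ler_pdivrMr// mul1r.
  rewrite cE; clear cE BE; move: B0e De C2e ce eps_ge0.
  by move: (D * eps) (C2 * eps) (2 / c * eps) (eps) => *; split; lra.
pose w := theta^-1 *: W.
have sw : w^T = w by rewrite /w linearZ /= sW.
have wle x : nrm (w *m x) <= eps * nrm x.
  rewrite -scalemxAl nrmZ ger0_norm ?invr_ge0 ?(ltW th0)// mulrC ler_pdivrMr//.
  by rewrite mulrAC /eps divfK ?gt_eqF.
have AE x : spiked_op w e alpha x = theta^-1 *: (A *m x).
  rewrite /spiked_op /A mulmxDl scalerDr -!scalemxAl; congr (_ + _).
  rewrite scalerA mulVf ?gt_eqF// scale1r mulmx_suml; apply: eq_bigr => j _.
  rewrite -scalemxAl -mulmxA -scalerA; congr (_ *: _).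
  by rewrite [_^T *m x]mx11_scalar mul_mx_scalar.
have sA : A^T = A.
  rewrite /A linearD /= sW linearZ /= linear_sum /=; congr (_ + _ *: _).
  by apply: eq_bigr => j _; rewrite linearZ /= trmx_mul trmxK.
have [q [Aq qo lam_anti]] := ordered_eigenbasis sA.
have near : `|lambda A i / theta - alpha i| < r.
  have := @nth_eigenvalue_near_spike R N k w e alpha eps a0 r S sw wle ee a0_gt0 a0_le
    r_gt0 r_le sep (lexx _) eps_ge0 e1 e2 e3 q (fun t => lambda A t / theta) _ qo _
    alpha_anti i (Ordinal iN) erefl.
  apply.
    by move=> t; rewrite AE Aq scalerA mulrC.
  by move=> s t st; rewrite ler_pM2r ?invr_gt0// lam_anti.
have nv : nrm v = 1 by rewrite /nrm /dot v1 mxE eqxx sqrtr1.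
have eta_ge0 : 0 <= (Num.sqrt N%:R)^-1 :> R by rewrite invr_ge0 sqrtr_ge0.
have iter_w n x : iter_mx w n x = theta ^- n *: iter_mx W n x.
  elim: n => [|n IH]; first by rewrite expr0 invr1 scale1r.
  rewrite /iter_mx !iterS -/(iter_mx w n x) IH -scalemxAl -scalemxAr scalerA.
  by rewrite -invfM -exprS.
apply: normmx_le => [|l].
  by rewrite mulr_ge0 ?(ltW C_gt0)// mulr_ge0.
apply: (@spiked_eigenvector_sup R N k w e alpha eps a0 r S wle ee a0_gt0 a0_le
  r_gt0 r_le sep (lexx _) eps_ge0 e1 e3 (lambda A i / theta) v i _ H n0 nv _ near vs
  eta_ge0 H0 e4 _ _ tail l).
- by rewrite AE Av scalerA mulrC.
- exact: esup.
- move=> j n l' nn; rewrite iter_w mxE normrM ger0_norm; last first.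
    by rewrite invr_ge0 exprn_ge0// ltW.
  rewrite mulrC ler_pdivrMr ?exprn_gt0// (le_trans (wsup j n l' nn))//.
  by rewrite mulrC -mulrA /eps expr_div_n divfK// expf_neq0 ?gt_eqF.
Qed.


(** * Expectations of monomials in independent variables *)

Section Expectation.
Context d (T : measurableType d) (R : realType) (P : probability T R).

Definition itg (f : T -> R) : Prop := P.-integrable setT (EFin \o f).

Lemma itgP (f : T -> R) : itg f <-> measurable_fun setT f /\ (\int[P]_w `|f w|%:E < +oo)%E.
Proof.
split=> [/integrableP[/measurable_EFinP mf h]|[mf h]]; first by [].
by apply/integrableP; split => //; exact/measurable_EFinP.
Qed.

Lemma itg_measurable f : itg f -> measurable_fun setT f.
Proof. by move=> /itgP[]. Qed.

Lemma le_itg (f g : T -> R) : measurable_fun setT f -> itg g ->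
  (forall w, `|f w| <= g w) -> itg f.
Proof.
move=> mf ig fg; apply: le_integrable ig => //; first exact/measurable_EFinP.
by move=> w _ /=; rewrite lee_fin (le_trans (fg w))// ler_norm.
Qed.

Lemma itg_cst c : itg (fun=> c).
Proof. exact: finite_measure_integrable_cst. Qed.

Lemma itgD f g : itg f -> itg g -> itg (fun w => f w + g w).
Proof. exact: integrableD. Qed.

Lemma itgZ c f : itg f -> itg (fun w => c * f w).
Proof. exact: integrableZl. Qed.

Lemma ExpZ c f : itg f -> \int[P]_w (c * f w) = c * \int[P]_w f w.
Proof. by move=> ?; exact: RintegralZl. Qed.

Lemma ExpB f g : itg f -> itg g ->
  \int[P]_w (f w - g w) = \int[P]_w f w - \int[P]_w g w.
Proof. by move=> ? ?; exact: RintegralB. Qed.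

Lemma itg_norm f : itg f -> itg (fun w => `|f w|).
Proof. exact: integrable_norm. Qed.

Lemma itg_sum (I : Type) (s : seq I) (F : I -> T -> R) :
  (forall i, itg (F i)) -> itg (fun w => \sum_(i <- s) F i w).
Proof.
move=> h; elim: s => [|i s IH].
  by under [X in itg X]eq_fun do rewrite big_nil; exact: itg_cst.
by under [X in itg X]eq_fun do rewrite big_cons; exact: itgD.
Qed.

Lemma Rintegral_sum (I : Type) (s : seq I) (F : I -> T -> R) :
  (forall i, itg (F i)) ->
  \int[P]_w (\sum_(i <- s) F i w) = \sum_(i <- s) \int[P]_w F i w.
Proof.
move=> h; elim: s => [|i s IH].
  under eq_Rintegral do rewrite big_nil.
  by rewrite Rintegral_cst// mul0r big_nil.
under eq_Rintegral do rewrite big_cons.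
by rewrite RintegralD//; [rewrite IH big_cons|exact: h|exact: itg_sum].
Qed.

Lemma Rintegral_indic (A : set T) : measurable A ->
  \int[P]_w \1_A w = fine (P A).
Proof. by move=> mA; rewrite /Rintegral integral_indic// setIT. Qed.

Lemma Rintegral_dominated (f_ : nat -> T -> R) (f g : T -> R) :
  (forall n, measurable_fun setT (f_ n)) -> measurable_fun setT f -> itg g ->
  (forall w, f_ n w @[n --> \oo] --> f w) -> (forall n w, `|f_ n w| <= g w) ->
  \int[P]_w f_ n w @[n --> \oo] --> \int[P]_w f w.
Proof.
move=> mf_ mf ig cf fg.
have [||||i _ h] := @dominated_convergence _ _ _ P setT measurableT
    (fun n => EFin \o f_ n) (EFin \o f) (EFin \o g) _ _ _ ig.
- by move=> n; exact/measurable_EFinP.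
- exact/measurable_EFinP.
- by apply: aeW => w _; apply/fine_cvgP; split; [exact: nearW|exact: cf].
- by apply: aeW => w n _; rewrite lee_fin.
have /fine_cvgP[_ ] : (\int[P]_w (f_ n w)%:E @[n --> \oo] --> (\int[P]_w f w)%:E)%E.
  by rewrite /Rintegral fineK//; exact: integrable_fin_num.
by [].
Qed.

Import HBNNSimple.

Lemma Rintegral_indep_nnsfun (Z Y : T -> R) (phi : {nnsfun R >-> R}) :
  itg Z -> measurable_fun setT Y ->
  (forall B, measurable B -> \int[P]_w (Z w * \1_B (Y w)) =
     \int[P]_w Z w * \int[P]_w \1_B (Y w)) ->
  \int[P]_w (Z w * phi (Y w)) = \int[P]_w Z w * \int[P]_w phi (Y w).
Proof.
move=> iZ mY h; pose s := fset_set (range phi).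
have phiE w : phi (Y w) = \sum_(i < #|`s|) (s`_i * \1_(phi @^-1` [set s`_i]) (Y w)).
  exact: fimfunEord.
have mB i : measurable (phi @^-1` [set s`_i]) by [].
have mI i : measurable_fun setT (fun w => \1_(phi @^-1` [set s`_i]) (Y w) : R).
  by apply: measurableT_comp mY; exact: measurable_indic.
have b1 (B : set R) x : `|\1_B x : R| <= 1.
  by rewrite indicE; case: (_ \in _); rewrite ?normr1 ?normr0.
have i1 i : itg (fun w => \1_(phi @^-1` [set s`_i]) (Y w)).
  by apply: le_itg (mI i) (itg_cst 1) _ => w.
have i2 i : itg (fun w => Z w * \1_(phi @^-1` [set s`_i]) (Y w)).
  apply: le_itg (itg_norm iZ) _; first exact: measurable_funM (itg_measurable iZ) (mI i).
  by move=> w; rewrite normrM ler_piMr.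
under eq_Rintegral do rewrite phiE mulr_sumr.
have -> : \int[P]_w phi (Y w) = \int[P]_w
    (\sum_(i < #|` s|) s`_i * \1_(phi @^-1` [set s`_i]) (Y w)).
  by apply: eq_Rintegral => w _; exact: phiE.
rewrite !Rintegral_sum; [|by move=> i; exact: itgZ|]; last first.
  by move=> i; under [X in itg X]eq_fun do rewrite mulrCA; exact: itgZ.
rewrite mulr_sumr; apply: eq_bigr => i _.
under eq_Rintegral do rewrite mulrCA.
by rewrite (ExpZ _ (i2 i)) (ExpZ _ (i1 i)) h// mulrCA.
Qed.

(* Independence of [Z] and [Y], in the weak form that [Z] is uncorrelated with
   every event defined by [Y], already factors [E (Z g(Y))]. *)
Lemma Rintegral_indep (Z Y : T -> R) (g : R -> R) :
  itg Z -> measurable_fun setT Y -> measurable_fun setT g ->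
  itg (fun w => g (Y w)) -> itg (fun w => Z w * g (Y w)) ->
  (forall B, measurable B -> \int[P]_w (Z w * \1_B (Y w)) =
     \int[P]_w Z w * \int[P]_w \1_B (Y w)) ->
  \int[P]_w (Z w * g (Y w)) = \int[P]_w Z w * \int[P]_w g (Y w).
Proof.
move=> iZ mY mg ig iZg h.
have approx (f : R -> R) : measurable_fun setT f -> (forall x, 0 <= f x) ->
    exists a : {nnsfun R >-> R}^nat, (forall n x, a n x <= f x) /\
      (forall x, a n x @[n --> \oo] --> f x).
  move=> mf f0; have mf' : measurable_fun setT (EFin \o f) by exact/measurable_EFinP.
  exists (nnsfun_approx measurableT mf'); split => [n x|x].
    rewrite nnsfun_approxE -lee_fin; apply: (@le_approx _ _ _ _ (EFin \o f)) => // y _.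
    by rewrite lee_fin.
  have := @cvg_nnsfun_approx _ _ _ _ measurableT _ mf' (fun y _ => f0 y) x Logic.I.
  by move=> /fine_cvgP[].
have [a [ale acvg]] := approx g^\+ (measurable_funrpos mg) (funrpos_ge0 _).
have [b [ble bcvg]] := approx g^\- (measurable_funrneg mg) (funrneg_ge0 _).
(* The positive and negative parts of [g] are approximated from below, which gives [|F n| <= |g|]
   and so the dominating functions for both limits. *)
pose F n x := a n x - b n x.
have mF n : measurable_fun setT (F n).
  by apply: measurable_funB; exact: measurable_funPT.
have Fg n x : `|F n x| <= `|g x|.
  have -> : `|g x| = (g^\+ + g^\-) x by rewrite funrposDneg.
  have a0 : 0 <= a n x by []. have b0 : 0 <= b n x by [].
  have := ale n x; have := ble n x; rewrite /F ler_norml fctE => ? ?.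
  by apply/andP; split; lra.
have Fcvg x : F n x @[n --> \oo] --> g x.
  have -> : g x = (g^\+ - g^\-) x by rewrite funrposBneg.
  exact: cvgB.
have c1 : \int[P]_w (Z w * F n (Y w)) @[n --> \oo] --> \int[P]_w (Z w * g (Y w)).
  apply: (Rintegral_dominated (g := fun w => `|Z w * g (Y w)|)) => //.
  - move=> n; apply: measurable_funM; first exact: itg_measurable.
    exact: measurableT_comp.
  - exact: itg_measurable.
  - exact: itg_norm.
  - by move=> w; apply: cvgMl_tmp.
  - by move=> n w; rewrite !normrM ler_wpM2l.
have c2 : \int[P]_w F n (Y w) @[n --> \oo] --> \int[P]_w g (Y w).
  apply: (Rintegral_dominated (g := fun w => `|g (Y w)|)) => //.
  - by move=> n; exact: measurableT_comp.
  - exact: itg_measurable.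
  - exact: itg_norm.
have iF (phi : {nnsfun R >-> R}) : (forall x, phi x <= `|g x|) ->
    itg (fun w => phi (Y w)) /\ itg (fun w => Z w * phi (Y w)).
  move=> phile; have mphi : measurable_fun setT (fun w => phi (Y w)).
    by apply: measurableT_comp => //; exact: measurable_funPT.
  split; first by apply: le_itg mphi (itg_norm ig) _ => w; rewrite ger0_norm.
  apply: (le_itg _ (itg_norm iZg)).
    by apply: measurable_funM => //; exact: itg_measurable.
  by move=> w; rewrite !normrM ler_wpM2l// ger0_norm.
have c3 n : \int[P]_w (Z w * F n (Y w)) = \int[P]_w Z w * \int[P]_w F n (Y w).
  have [] := iF (a n) _.
    by move=> x; rewrite (le_trans (ale n x))// /funrpos ge_max ler_norm normr_ge0.
  have [] := iF (b n) _.
    move=> x; rewrite (le_trans (ble n x))// /funrneg ge_max -[X in _ <= X]normrN.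
    by rewrite ler_norm normr_ge0.
  move=> ib1 ib2 ia1 ia2.
  under eq_Rintegral do rewrite mulrBr.
  by rewrite !ExpB// !Rintegral_indep_nnsfun// mulrBr.
have c4 : \int[P]_w (Z w * F n (Y w)) @[n --> \oo] -->
    \int[P]_w Z w * \int[P]_w g (Y w).
  by under eq_fun do rewrite c3; exact: cvgMl_tmp.
by rewrite -(cvg_lim _ c1)// (cvg_lim _ c4).
Qed.

End Expectation.

(** With [m] the largest of the [|x i|], the product is at most [m ^+ n], which is one of the terms
    of the sum. This stands in for Hölder's inequality and costs only a factor [size s] in the
    moment bound. *)
Lemma prod_norm_le_sum (R : realType) (I : Type) (s : seq I) (x : I -> R) n :
  n = size s -> (0 < n)%N ->
  `|\prod_(i <- s) x i| <= \sum_(i <- s) `|x i| ^+ n.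
Proof.
move=> nE n0.
have [m m0 mle] : exists2 m : R, 0 <= m &
    (forall k, m ^+ k <= \sum_(i <- s) `|x i| ^+ k) /\ all (fun i => `|x i| <= m) s.
  case: s nE => [|i s] sE; first by rewrite sE in n0.
  clear; elim: s i => [|j s IH] i.
    exists `|x i| => //; split => [k|]; first by rewrite big_seq1.
    by rewrite /= lexx.
  have [m m0 [h1 /= /andP[h2 h3]]] := IH j.
  have [im|mi] := leP `|x i| m.
    exists m => //; split => [k|]; last by rewrite /= im h2.
    by rewrite big_cons (le_trans (h1 k))// lerDr exprn_ge0.
  exists `|x i| => //; split => [k|].
    by rewrite big_cons lerDl sumr_ge0// => ? _; rewrite exprn_ge0.
  rewrite /= lexx (le_trans h2 (ltW mi))/=.
  by apply: sub_all h3 => l /le_trans; apply; exact: ltW.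
case: mle => h1 h2; apply: le_trans (h1 n); rewrite nE normr_prod.
elim: s h2 {h1 nE n0} => [|i s IH] /=; first by rewrite big_nil expr0.
by move=> /andP[xi xs]; rewrite big_cons exprS ler_pM// ?prodr_ge0// IH.
Qed.

Lemma measurable_fun_prod_seq d (T : measurableType d) (R : realType) (I : Type)
    (s : seq I) (F : I -> T -> R) :
  (forall i, measurable_fun setT (F i)) ->
  measurable_fun setT (fun w => \prod_(i <- s) F i w).
Proof.
move=> mF; elim: s => [|i s IH].
  by under eq_fun do rewrite big_nil; exact: measurable_cst.
by under eq_fun do rewrite big_cons; exact: measurable_funM.
Qed.

Section Moments.
Context d (T : measurableType d) (R : realType) (P : probability T R).
Variables (I : choiceType) (D : set I) (X : I -> {RV P >-> R}) (B : R).
Hypothesis indep : mutually_independent D X.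
Hypothesis moments : forall i, D i ->
  ('E_P[X i] = 0)%E /\
  forall m : nat, (0 < m)%N ->
    ('E_P[fun w => (`|X i w| ^+ m)%R] <= (m%:R `^ (B * m%:R))%:E)%E.

Let mX i : measurable_fun setT (X i).
Proof. exact: measurable_funPT. Qed.

Lemma abs_moment i m : D i -> (0 < m)%N ->
  itg P (fun w => `|X i w| ^+ m) /\
  \int[P]_w `|X i w| ^+ m <= m%:R `^ (B * m%:R).
Proof.
move=> Di m0; have [_ /(_ m m0)] := moments Di; rewrite unlock => h.
have mf : measurable_fun setT (fun w => `|X i w| ^+ m).
  by apply: measurable_funX; exact: measurableT_comp.
have it : itg P (fun w => `|X i w| ^+ m).
  apply/itgP; split => //.
  under eq_integral do rewrite ger0_norm ?exprn_ge0//.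
  by rewrite (le_lt_trans h)// ltry.
split => //; rewrite -lee_fin /Rintegral fineK//.
exact: integrable_fin_num it.
Qed.

Definition monomial (s : seq I) (w : T) : R := \prod_(i <- s) X i w.

Lemma measurable_monomial s : measurable_fun setT (monomial s).
Proof.
exact: measurable_fun_prod_seq.
Qed.

Lemma power_sum_bound s n : (0 < n)%N -> {in s, forall i, D i} ->
  itg P (fun w => \sum_(i <- s) `|X i w| ^+ n) /\
  \int[P]_w (\sum_(i <- s) `|X i w| ^+ n) <= (size s)%:R * n%:R `^ (B * n%:R).
Proof.
move=> n0; elim: s => [|i s IH] sD.
  under [X in itg _ X]eq_fun do rewrite big_nil.
  under eq_Rintegral do rewrite big_nil.
  by split; [exact: itg_cst|rewrite Rintegral_cst// !mul0r].
have [|iss IHs] := IH; first by move=> j js; apply: sD; rewrite in_cons js orbT.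
have [ii IHi] := abs_moment (sD _ (mem_head _ _)) n0.
under [X in itg _ X]eq_fun do rewrite big_cons.
under eq_Rintegral do rewrite big_cons.
split; first exact: itgD.
by rewrite RintegralD// /= -natr1 mulrDl mul1r addrC lerD.
Qed.

Lemma itg_monomial s : {in s, forall i, D i} -> itg P (monomial s).
Proof.
move=> sD; have [s0|s0] := posnP (size s).
  move/size0nil: s0 => ->; rewrite /monomial.
  by under [X in itg _ X]eq_fun do rewrite big_nil; exact: itg_cst.
apply: le_itg (measurable_monomial s) (power_sum_bound s0 sD).1 _ => w.
exact: prod_norm_le_sum.
Qed.

Lemma monomial_bound s : {in s, forall i, D i} -> (0 < size s)%N ->
  `|\int[P]_w monomial s w| <= (size s)%:R * (size s)%:R `^ (B * (size s)%:R).
Proof.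
move=> sD s0; have ims := itg_monomial sD.
apply: (le_trans (le_normr_Rintegral measurableT ims)).
have [ips] := power_sum_bound s0 sD; apply: le_trans.
apply: le_Rintegral => //; first exact: itg_norm.
by move=> w _; exact: prod_norm_le_sum.
Qed.

Definition evented (J1 J2 : seq I) (m : I -> nat) (C : I -> set R) (w : T) : R :=
  (\prod_(j <- J1) X j w ^+ m j) * \prod_(j <- J2) \1_(C j) (X j w).

(** Independence is given for events only. Induction on [J1] upgrades one variable at a time from an
    indicator to a power: [Rintegral_indep] is applied to [X j] and the product of the others, and
    its premise is the induction hypothesis with [j] added to [J2]. This is why powers and arbitrary
    events occur together; [J1 = [::]] is independence itself. *)
Lemma factor_evented J1 J2 m C :
  uniq (J1 ++ J2) -> {in J1 ++ J2, forall i, D i} -> (forall j, measurable (C j)) ->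
  itg P (evented J1 J2 m C) /\
  \int[P]_w evented J1 J2 m C w =
    (\prod_(j <- J1) \int[P]_w (X j w ^+ m j)) *
    \prod_(j <- J2) \int[P]_w \1_(C j) (X j w).
Proof.
have m1 (C0 : set R) j : measurable C0 -> measurable_fun setT (fun w => \1_C0 (X j w) : R).
  by move=> mC; apply: measurableT_comp (mX j); exact: measurable_indic.
have itgE J1' J2' C' : (forall j, measurable (C' j)) -> {in J1', forall i, D i} ->
    itg P (evented J1' J2' m C').
  move=> mC hD.
  (* Indicators are at most 1, so the absolute value of the monomial repeating [j] [m j] times is an
     integrable bound. *)
  pose s := flatten [seq nseq (m j) j | j <- J1'].
  apply: (le_itg _ (itg_norm (itg_monomial (s := s) _))).
  - apply: measurable_funM.
      by apply: measurable_fun_prod_seq => j; exact: measurable_funX.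
    by apply: measurable_fun_prod_seq => j; exact: m1.
  - by move=> i /flattenP[_ /mapP[j jJ ->]] /nseqP[-> _]; exact: hD.
  - move=> w; rewrite normrM [X in _ <= X](_ : _ = `|\prod_(j <- J1') X j w ^+ m j|).
      rewrite ler_piMr// normr_prod; elim: J2' => [|j J IH]; rewrite ?big_nil// big_cons.
      rewrite mulr_ile1// ?prodr_ge0//.
      by rewrite indicE; case: (_ \in _); rewrite ?normr1 ?normr0.
    rewrite /monomial big_flatten big_map; congr `|_|.
    by apply: eq_bigr => j _; rewrite big_nseq iter_mulr_1.
elim: J1 J2 C => [|j J1 IH] J2 C uJ hD mC;
  (split; first by apply: itgE => // i iJ; apply: hD; rewrite mem_cat iJ).
  rewrite big_nil mul1r /evented.
  under eq_Rintegral do rewrite big_nil mul1r.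
  transitivity (\int[P]_w \1_(\bigcap_(j in [set` J2]) (X j @^-1` C j)) w).
    apply: eq_Rintegral.
    move=> w _; rewrite indicE; case: (boolP (w \in _)) => [|].
      rewrite inE => h; rewrite big_seq big1// => j /h /= Cj.
      by rewrite indicE mem_set.
    rewrite notin_setE => /existsNP[j /not_implyP[/= jJ Cj]].
    by rewrite (big_rem j)//= indicE memNset ?mul0r.
  rewrite Rintegral_indic; last first.
    apply: fin_bigcap_measurable => // j _.
    by rewrite -[X in measurable X]setTI; exact: mX.
  have := indep; rewrite /mutually_independent => /(_ [fset j in J2]%fset _ C) h.
  have -> : [set` J2] = [set` [fset j in J2]%fset].
    by apply/seteqP; split => j /=; rewrite !inE.
  rewrite h => [|j /=|j _]; [|by rewrite !inE => /hD|exact: mC].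
  rewrite (perm_big J2) /=; last first.
    by apply: uniq_perm => // j; rewrite !inE.
  rewrite big_seq [RHS]big_seq.
  have fP j : P (X j @^-1` C j) \is a fin_num.
    by apply: fin_num_measure; rewrite -[X in measurable X]setTI; exact: mX.
  have -> : (\prod_(i <- J2 | i \in J2) P (X i @^-1` C i) =
      (\prod_(i <- J2 | i \in J2) fine (P (X i @^-1` C i)))%:E)%E.
    elim/big_rec2: _ => // j y z _ ->; by rewrite EFinM fineK.
  rewrite /=; apply: eq_bigr => j _.
  rewrite -(Rintegral_indic _); last by rewrite -[X in measurable X]setTI; exact: mX.
  by apply: eq_Rintegral => w _; rewrite !indicE.
have [jD JD] : D j /\ {in J1 ++ J2, forall i, D i}.
  by split; [apply: hD; rewrite mem_head|move=> i iJ; apply: hD; rewrite in_cons iJ orbT].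
move: uJ; rewrite cat_cons cons_uniq => /andP[jJ uJ].
have [iZ ZE] := IH J2 C uJ JD mC.
transitivity (\int[P]_w (evented J1 J2 m C w * X j w ^+ m j)).
  by apply: eq_Rintegral => w _; rewrite /evented big_cons; ring.
rewrite (@Rintegral_indep _ _ _ _ (evented J1 J2 m C) (X j) (fun x => x ^+ m j))//.
- by rewrite ZE big_cons; ring.
- have [->|mj] := posnP (m j); first exact: itg_cst.
  apply: le_itg (abs_moment jD mj).1 _; first exact: measurable_funX.
  by move=> w; rewrite normrX.
- have := itgE (j :: J1) J2 C mC; rewrite /evented.
  under eq_fun do rewrite big_cons -mulrA mulrC.
  apply => i iJ; apply: hD; move: iJ; rewrite !(in_cons, mem_cat).
  by case/orP => ->; rewrite ?orbT.
(* Only the event attached to [j] changes, and [j] occurs neither in [J1] nor in [J2]. *)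
- move=> C0 mC0; pose C' i := if i == j then C0 else C i.
  have mC' i : measurable (C' i) by rewrite /C'; case: eqP.
  have CE (J : seq I) w : j \notin J ->
      \prod_(i <- J) \1_(C' i) (X i w) = \prod_(i <- J) \1_(C i) (X i w) :> R.
    move=> jn; rewrite big_seq [RHS]big_seq; apply: eq_bigr => i iJ.
    by rewrite /C' (_ : (i == j) = false)//; apply: contraNF jn => /eqP <-.
  have jJ2 : j \notin J2 by apply: contra jJ; rewrite mem_cat orbC => ->.
  have Cj : C' j = C0 by rewrite /C' eqxx.
  transitivity (\int[P]_w evented J1 (j :: J2) m C' w).
    by apply: eq_Rintegral => w _; rewrite /evented big_cons CE// Cj; ring.
  have [|||_ ->] := IH (j :: J2) C'.
  - by rewrite uniq_catC cat_cons cons_uniq mem_cat orbC -mem_cat jJ uniq_catC.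
  - move=> i; rewrite mem_cat in_cons orbCA => /orP[/eqP->//|iJ].
    by apply: JD; rewrite mem_cat.
  - exact: mC'.
  - rewrite big_cons ZE Cj -!mulrA; congr (_ * _); rewrite mulrC; congr (_ * _).
    rewrite big_seq [RHS]big_seq; apply: eq_bigr => i iJ.
    by rewrite /C' (_ : (i == j) = false)//; apply: contraNF jJ2 => /eqP <-.
Qed.

(** Grouping equal variables turns the monomial into powers of distinct ones; the expectation
    factors, and the factor of [i] is its mean. *)
Lemma monomial_single s i : {in s, forall i, D i} -> count_mem i s = 1%N ->
  \int[P]_w monomial s w = 0.
Proof.
move=> sD si; have ins : i \in s by rewrite -has_pred1 has_count si.
have [||_|_ h] := @factor_evented (undup s) [::] (fun j => count_mem j s) (fun=> setT).
- by rewrite cats0 undup_uniq.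
- by move=> j; rewrite cats0 mem_undup => /sD.
- exact: measurableT.
transitivity (\int[P]_w evented (undup s) [::] (fun j => count_mem j s) (fun=> setT) w).
  apply: eq_Rintegral => w _; rewrite /evented big_nil mulr1 /monomial.
  by rewrite -big_undup_iterop_count.
rewrite h big_nil mulr1 (big_rem i) ?mem_undup//= si.
have [EX _] := moments (sD _ ins).
rewrite (_ : \int[P]_w _ = 0) ?mul0r//.
by move: EX; rewrite unlock /Rintegral => ->.
Qed.

End Moments.


(** * Counting walks *)

Fixpoint words (A : Type) (L : seq A) (n : nat) : seq (seq A) :=
  if n is n'.+1 then [seq x :: u | x <- L, u <- words L n'] else [:: [::]].

Lemma size_words (A : Type) (L : seq A) n : size (words L n) = (size L ^ n)%N.
Proof. by elim: n => //= n IH; rewrite size_allpairs IH expnS. Qed.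

Lemma mem_words (A : eqType) (L : seq A) n u :
  (u \in words L n) = (size u == n) && all (mem L) u.
Proof.
elim: n u => [|n IH] u; first by rewrite mem_seq1; case: u.
case: u => [|x u] /=; first by apply/allpairsP => -[[] y v []].
rewrite eqSS andbCA -IH; apply/allpairsP/andP => [[[y v] /= [yL vw [-> ->]]]|[xL uw]].
  by [].
by exists (x, u).
Qed.

Lemma uniq_words (A : eqType) (L : seq A) n : uniq L -> uniq (words L n).
Proof.
move=> uL; elim: n => //= n IH; apply: allpairs_uniq => //.
by move=> [x u] [y v] _ _ /= [-> ->].
Qed.

Lemma expr_sum_words (R : comNzRingType) (A : Type) (L : seq A) (F : A -> R) n :
  (\sum_(x <- L) F x) ^+ n = \sum_(f <- words L n) \prod_(x <- f) F x.
Proof.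
elim: n => [|n IH] /=; first by rewrite expr0 big_seq1 big_nil.
rewrite exprS IH big_allpairs_dep mulr_suml; apply: eq_bigr => x _.
by rewrite mulr_sumr; apply: eq_bigr => u _; rewrite big_cons.
Qed.

Fixpoint steps (V : Type) (x : V) (u : seq V) : seq (V * V) :=
  if u is y :: u' then (x, y) :: steps y u' else [::].

Lemma size_steps (V : Type) (x : V) u : size (steps x u) = size u.
Proof. by elim: u x => //= y u IH x; rewrite IH. Qed.

Lemma map_snd_steps (V : Type) (x : V) u : map snd (steps x u) = u.
Proof. by elim: u x => //= y u IH x; rewrite IH. Qed.

Lemma iter_mx_walks (R : realType) N (W : 'M[R]_N) n (g : 'cV[R]_N) l :
  iter_mx W n g l 0 = \sum_(u <- words (enum 'I_N) n)
    (\prod_(p <- steps l u) W p.1 p.2) * g (last l u) 0.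
Proof.
elim: n l => [|n IH] l; first by rewrite /= big_seq1 /= big_nil mul1r.
rewrite /iter_mx iterS -/(iter_mx W n g) mxE /= big_allpairs_dep big_enum /=.
apply: eq_bigr => x _; rewrite IH mulr_sumr; apply: eq_bigr => u _.
by rewrite big_cons mulrA.
Qed.

Lemma iter_mx_walks_pow (R : realType) N (W : 'M[R]_N) n (g : 'cV[R]_N) l r :
  iter_mx W n g l 0 ^+ r = \sum_(f <- words (words (enum 'I_N) n) r)
    (\prod_(p <- flatten [seq steps l u | u <- f]) W p.1 p.2) *
    \prod_(u <- f) g (last l u) 0.
Proof.
rewrite iter_mx_walks expr_sum_words; apply: eq_bigr => f _.
by rewrite big_flatten big_map -big_split.
Qed.

Section VertexCount.
Context {N : nat}.
Implicit Types (S : seq 'I_N) (s : seq ('I_N * 'I_N)).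

(** The representative of an unordered pair under which [sym_mx] stores the variable, so equal edges
    mean equal variables. *)
Definition edge (p : 'I_N * 'I_N) : 'I_N * 'I_N :=
  if (p.1 <= p.2)%N then p else (p.2, p.1).

(** Weaker than being a walk: a step may start at any vertex seen before. This allows the jump back
    to the root between consecutive walks. *)
Fixpoint explored S s : bool :=
  if s is p :: s' then (p.1 \in S) && explored (p.2 :: S) s' else true.

Lemma explored_steps S x u s : x \in S ->
  (forall S', {subset S <= S'} -> explored S' s) -> explored S (steps x u ++ s).
Proof.
elim: u x S => [|y u IH] x S xS h /=; first exact: h.
rewrite xS /=; apply: IH; first by rewrite mem_head.
by move=> S' SS'; apply: h => z zS; apply: SS'; rewrite in_cons zS orbT.
Qed.

Lemma explored_walks S l f : l \in S -> explored S (flatten [seq steps l u | u <- f]).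
Proof.
elim: f S => //= u f IH S lS; apply: explored_steps => // S' SS'.
by apply: IH; exact: SS'.
Qed.

(* Each newly visited vertex is reached through a new edge. *)
Lemma explored_count S Es s : explored S s ->
  (forall e, e \in Es -> (e.1 \in S) && (e.2 \in S)) ->
  (size (undup S) <= (size (undup Es)).+1)%N ->
  (size (undup (catrev (map snd s) S)) <=
     (size (undup (catrev (map edge s) Es))).+1)%N.
Proof.
elim: s S Es => [|[a b] s IH] S Es //= /andP[aS es] hE hS; apply: IH => //.
  move=> e; rewrite in_cons => /orP[/eqP ->|/hE/andP[e1 e2]].
    rewrite /edge /= !in_cons; case: ifP => _ /=; rewrite ?eqxx ?aS ?orbT//.
  by rewrite !in_cons e1 e2 !orbT.
rewrite /=; case: ifP => bS; last first.
  suff -> : (edge (a, b) \in Es) = false by [].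
  apply/negP => /hE; rewrite /edge /=; case: ifP => _ /=; rewrite bS ?andbF//.
by case: ifP => _ //=; rewrite (leq_trans hS).
Qed.

Lemma double_undup_le (A : eqType) (t : seq A) :
  (forall x, x \in t -> (1 < count_mem x t)%N) -> ((size (undup t)).*2 <= size t)%N.
Proof.
move=> h; rewrite -[X in (_ <= X)%N](perm_size (perm_count_undup t)).
rewrite size_flatten /shape -map_comp.
have : {subset undup t <= t} by move=> x; rewrite mem_undup.
elim: (undup t) => //= x r IH rt; rewrite size_nseq doubleS -add2n leq_add//.
  by apply: h; apply: rt; rewrite mem_head.
by apply: IH => y yr; apply: rt; rewrite in_cons yr orbT.
Qed.

Definition walk_edges l (f : seq (seq 'I_N)) :=
  map edge (flatten [seq steps l u | u <- f]).

Definition no_single_edge l f :=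
  all (fun e => count_mem e (walk_edges l f) != 1%N) (walk_edges l f).

(** The vertices exceed the distinct edges by at most one, and each distinct edge uses up at least
    two of the steps. *)
Lemma vertex_count l f : no_single_edge l f ->
  (size (undup (l :: flatten f)) <= (size (walk_edges l f))./2.+1)%N.
Proof.
move=> /allP h.
have hd : ((size (undup (walk_edges l f))).*2 <= size (walk_edges l f))%N.
  apply: double_undup_le => x xt; have := h x xt.
  by move: xt; rewrite -has_pred1 has_count; case: (count _ _) => [|[]].
have := @explored_count [:: l] [::] (flatten [seq steps l u | u <- f])
  (explored_walks _ (mem_head _ _)) (fun e => ltac:(by [])) isT.
rewrite !catrevE cats0 -/(walk_edges l f) => hc.
apply: leq_trans (_ : _ <= (size (undup (walk_edges l f))).+1)%N _; last first.
  by rewrite ltnS geq_half_double.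
have <- := perm_size (perm_undup (mem_rev (walk_edges l f))).
apply: leq_trans hc; apply/eq_leq/perm_size/perm_undup => x.
rewrite mem_cat mem_rev mem_seq1 in_cons orbC; congr (_ || _).
rewrite map_flatten -map_comp; congr (x \in flatten _).
by rewrite -[LHS]map_id; apply: eq_map => u; rewrite /= map_snd_steps.
Qed.

Lemma size_walk_edges l n r f :
  f \in words (words (enum 'I_N) n) r -> size (walk_edges l f) = (r * n)%N.
Proof.
rewrite mem_words => /andP[/eqP <- /allP h]; rewrite size_map.
elim: f h => //= u f IH h; rewrite size_cat size_steps mulSn IH; last first.
  by move=> v vf; apply: h; rewrite in_cons vf orbT.
have := h u (mem_head _ _); rewrite /= mem_words => /andP[/eqP -> _] //.
Qed.

(* A family of words with at most [m] letters factors through a word of length [m]. *)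
Lemma count_few_letters l n r m (Q : pred (seq (seq 'I_N))) :
  (forall f, f \in words (words (enum 'I_N) n) r -> Q f ->
     (size (undup (l :: flatten f)) <= m)%N) ->
  (count Q (words (words (enum 'I_N) n) r) <= N ^ m * m ^ (r * n))%N.
Proof.
move=> h; pose K := [seq map (map (nth l g)) c | g <- words (enum 'I_N) m,
                      c <- words (words (iota 0 m) n) r].
have <- : size K = (N ^ m * m ^ (r * n))%N.
  by rewrite size_allpairs !size_words size_enum_ord size_iota (mulnC r) expnM.
rewrite -size_filter; apply: uniq_leq_size.
  by rewrite filter_uniq// !uniq_words// enum_uniq.
move=> f; rewrite mem_filter => /andP[Qf fw]; have := h f fw Qf.
set vs := undup _ => vm; apply/allpairsP.
(* The alphabet of [f] is padded with copies of [l] to length exactly [m], and [f] is encoded by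
   positions in it. *)
exists (vs ++ nseq (m - size vs) l, map (map (index^~ vs)) f) => /=.
have idx u x : u \in f -> x \in u -> x \in vs.
  by move=> uf xu; rewrite mem_undup in_cons; apply/orP; right; apply/flattenP; exists u.
move: (fw); rewrite mem_words => /andP[/eqP fr /allP fL]; split.
- rewrite mem_words size_cat size_nseq subnKC// eqxx /=.
  by apply/allP => x _; rewrite /= mem_enum.
- rewrite mem_words size_map fr eqxx /=; apply/allP => _ /mapP[u uf ->].
  have := fL u uf; rewrite /= !mem_words size_map => /andP[-> _] /=.
  apply/allP => _ /mapP[x xu ->]; rewrite /= mem_iota add0n /=.
  by rewrite (leq_trans _ vm)// index_mem; exact: idx uf xu.
- rewrite -map_comp -[LHS]map_id; apply/eq_in_map => u uf /=.
  rewrite -map_comp -[LHS]map_id; apply/eq_in_map => x xu /=.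
  by rewrite nth_cat index_mem (idx u x uf xu) nth_index// (idx u x uf xu).
Qed.

End VertexCount.


(** * Moments and tails of powers of the random matrix *)

Lemma markov_itg d (T : measurableType d) (R : realType) (P : probability T R)
    (Z : T -> R) (s : R) : itg P Z -> (forall w, 0 <= Z w) -> 0 < s ->
  measurable [set w | s <= Z w] /\
  fine (P [set w | s <= Z w]) <= \int[P]_w Z w / s.
Proof.
move=> iZ Z0 s0.
have mA : measurable [set w | s <= Z w].
  rewrite -[X in measurable X]setTI; have := itg_measurable iZ.
  by move=> /(_ measurableT _ (measurable_itv `[s, +oo[)); congr measurable;
    apply/seteqP; split => w /=; rewrite in_itv/= andbT.
split => //; rewrite ler_pdivlMr// mulrC -Rintegral_indic//.
have iA : itg P \1_[set w | s <= Z w] by exact: integrable_indic.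
rewrite -ExpZ//; apply: le_Rintegral => //; first exact: (itgZ _ iA).
move=> w _; rewrite indicE; case: (boolP (w \in _)) => [|_].
  by rewrite inE/= mulr1.
by rewrite mulr0.
Qed.

Section MatrixMoments.
Context d (T : measurableType d) (R : realType) (P : probability T R).
Variables (N : nat) (X : 'I_N -> 'I_N -> {RV P >-> R}) (B : R).
Hypothesis indep :
  mutually_independent [set p : 'I_N * 'I_N | (p.1 <= p.2)%N] (fun p => X p.1 p.2).
Hypothesis moments : forall j l : 'I_N, (j <= l)%N ->
  ('E_P[X j l] = 0)%E /\
  forall m : nat, (0 < m)%N ->
    ('E_P[fun w => (`|X j l w| ^+ m)%R] <= (m%:R `^ (B * m%:R))%:E)%E.

Let W w : 'M[R]_N := sym_mx (fun j l => X j l w).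

Let moments' (p : 'I_N * 'I_N) : [set p : 'I_N * 'I_N | (p.1 <= p.2)%N] p ->
  ('E_P[X p.1 p.2] = 0)%E /\
  forall m : nat, (0 < m)%N ->
    ('E_P[fun w => (`|X p.1 p.2 w| ^+ m)%R] <= (m%:R `^ (B * m%:R))%:E)%E.
Proof. exact: moments. Qed.

Let mon := @monomial _ T R P ('I_N * 'I_N)%type (fun p => X p.1 p.2).

Let WE w p : W w p.1 p.2 = X (edge p).1 (edge p).2 w.
Proof. by rewrite /W mxE /edge; case: ifP. Qed.

Let edgeD (p : 'I_N * 'I_N) : ((edge p).1 <= (edge p).2)%N.
Proof.
by rewrite /edge; case: ifP => //= /negbT; rewrite -ltnNge => /ltnW.
Qed.

Lemma iter_sym_mx_monomial n (g : 'cV[R]_N) l r w :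
  iter_mx (W w) n g l 0 ^+ r = \sum_(f <- words (words (enum 'I_N) n) r)
    (\prod_(u <- f) g (last l u) 0) * mon (walk_edges l f) w.
Proof.
rewrite iter_mx_walks_pow; apply: eq_bigr => f _; rewrite mulrC; congr (_ * _).
by rewrite /mon /monomial big_map; apply: eq_bigr => p _; exact: WE.
Qed.

Let walk_edgesD l f : {in walk_edges l f, forall p : 'I_N * 'I_N,
  [set p : 'I_N * 'I_N | (p.1 <= p.2)%N] p}.
Proof. by move=> _ /mapP[p _ ->]; exact: edgeD. Qed.

Let itg_walk l f : itg P (mon (walk_edges l f)).
Proof. exact: itg_monomial moments' _ (@walk_edgesD l f). Qed.

Lemma itg_iter_mx n (g : 'cV[R]_N) l r :
  itg P (fun w => iter_mx (W w) n g l 0 ^+ r).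
Proof.
under [X in itg _ X]eq_fun do rewrite iter_sym_mx_monomial.
by apply: itg_sum => f; exact: itgZ.
Qed.

(** The bound reads: one [G] for the endpoint of each of the [r] walks, the number of families
    without a single edge, and the bound for one monomial of degree [r * n]. *)
Lemma iter_mx_moment n (g : 'cV[R]_N) l r (G : R) :
  (0 < r * n)%N -> (forall i, `|g i 0| <= G) ->
  `|\int[P]_w (iter_mx (W w) n g l 0 ^+ r)| <=
    G ^+ r * ((N ^ (r * n)./2.+1 * (r * n)./2.+1 ^ (r * n))%:R *
    ((r * n)%:R * (r * n)%:R `^ (B * (r * n)%:R))).
Proof.
set M := (r * n)%N => M0 gG.
under eq_Rintegral do rewrite iter_sym_mx_monomial.
rewrite Rintegral_sum => [|f]; last exact: itgZ.
rewrite (le_trans (ler_norm_sum _ _ _))//.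
pose K := M%:R * M%:R `^ (B * M%:R) : R.
have K0 : 0 <= K by rewrite mulr_ge0 ?powR_ge0.
have G0 : 0 <= G by rewrite (le_trans _ (gG l)).
pose L := words (words (enum 'I_N) n) r.
have step f : f \in L -> `|\int[P]_w (\prod_(u <- f) g (last l u) 0 *
    mon (walk_edges l f) w)| <= if no_single_edge l f then G ^+ r * K else 0.
  move=> fL; rewrite ExpZ// normrM.
  have sz := size_walk_edges l fL.
  case: ifP => [_|/negbT/allPn[e ef]].
    apply: ler_pM => //.
      rewrite normr_prod; have : size f = r.
        by move: fL; rewrite mem_words => /andP[/eqP].
      move=> <-; elim: f {fL sz} => [|u f IH]; first by rewrite big_nil.
      by rewrite big_cons exprS ler_pM// prodr_ge0.
    have := monomial_bound moments' (@walk_edgesD l f).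
    by rewrite sz => /(_ M0).
  rewrite negbK => /eqP c1.
  by rewrite (monomial_single indep moments' (@walk_edgesD l f) c1) normr0 mulr0.
rewrite big_seq; apply: le_trans (ler_sum _ step) _.
rewrite -big_seq -big_mkcond big_const_seq iter_addr_0.
rewrite -[leLHS]mulr_natr -mulrA ler_wpM2l ?exprn_ge0// mulrC ler_wpM2r// ler_nat.
apply: (@count_few_letters _ l) => f fL /vertex_count.
by rewrite (size_walk_edges l fL).
Qed.

End MatrixMoments.

Lemma fine_probU d (T : measurableType d) (R : realType) (P : probability T R)
    (A C : set T) (a c : R) :
  measurable A -> measurable C -> fine (P A) <= a -> fine (P C) <= c ->
  fine (P (A `|` C)) <= a + c.
Proof.
move=> mA mC Aa Cc; apply: le_trans (lerD Aa Cc).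
have fA := fin_num_measure P A mA; have fC := fin_num_measure P C mC.
rewrite -fineD// fine_le//; last exact: measureU2.
  by apply: fin_num_measure; exact: measurableU.
by rewrite fin_numD fA fC.
Qed.

Lemma union_bound d (T : measurableType d) (R : realType) (P : probability T R)
    (I : finType) (F : I -> set T) (c : R) :
  (forall i, measurable (F i) /\ fine (P (F i)) <= c) ->
  measurable [set w | exists i, F i w] /\
  fine (P [set w | exists i, F i w]) <= #|I|%:R * c.
Proof.
move=> h; have -> : [set w | exists i, F i w] = [set w | exists2 i, i \in enum I & F i w].
  apply/seteqP; split => w /= -[i Fi]; last by exists i.
  by exists i; rewrite ?mem_enum.
rewrite cardE; elim: (enum I) => [|i r [mr Pr]].
  have -> : [set w | exists2 i, i \in [::] & F i w] = set0.
    by apply/seteqP; split => w // -[].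
  by split => //; rewrite measure0 mul0r.
have -> : [set w | exists2 j, j \in i :: r & F j w] =
    F i `|` [set w | exists2 j, j \in r & F j w].
  apply/seteqP; split => w /=.
    by move=> [j]; rewrite in_cons => /orP[/eqP ->|]; [left|right; exists j].
  by move=> [Fi|[j jr Fj]]; [exists i|exists j]; rewrite // in_cons ?eqxx ?jr ?orbT.
have [mi Pi] := h i; split; first exact: measurableU.
by rewrite /= -natr1 mulrDl mul1r addrC; exact: fine_probU.
Qed.

Section TailBounds.
Context d (T : measurableType d) (R : realType) (P : probability T R).
Variables (N : nat) (X : 'I_N -> 'I_N -> {RV P >-> R}) (B : R).
Hypothesis indep :
  mutually_independent [set p : 'I_N * 'I_N | (p.1 <= p.2)%N] (fun p => X p.1 p.2).
Hypothesis B_gt0 : 0 < B.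
Hypothesis moments : forall j l : 'I_N, (j <= l)%N ->
  ('E_P[X j l] = 0)%E /\
  forall m : nat, (0 < m)%N ->
    ('E_P[fun w => (`|X j l w| ^+ m)%R] <= (m%:R `^ (B * m%:R))%:E)%E.

Let W w : 'M[R]_N := sym_mx (fun j l => X j l w).

(** Markov's inequality for the moment bound with [r * n = 2 m]. The combinatorial and moment
    factors are absorbed into powers of [c] and of [c] to the power [B], both of exponent [2 m]. *)
Lemma iter_mx_tail n (g : 'cV[R]_N) l r m (G c s : R) :
  (r * n = m.*2)%N -> (0 < m)%N -> (forall i, `|g i 0| <= G) ->
  (4 * m)%:R <= c -> 0 < s ->
  (forall w, 0 <= iter_mx (W w) n g l 0 ^+ r) ->
  measurable [set w | s <= iter_mx (W w) n g l 0 ^+ r] /\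
  fine (P [set w | s <= iter_mx (W w) n g l 0 ^+ r]) <=
    G ^+ r * N%:R ^+ m.+1 * (c * c `^ B) ^+ m.*2 / s.
Proof.
move=> rn m0 gG mc s0 pos.
have G0 : 0 <= G by rewrite (le_trans _ (gG l)).
have [mA hA] := markov_itg (itg_iter_mx moments n g l r) pos s0.
split => //; apply: (le_trans hA); rewrite ler_pM2r ?invr_gt0//.
rewrite (le_trans (ler_norm _))//.
have := iter_mx_moment indep moments (n := n) l (r := r) _ gG.
rewrite rn doubleK double_gt0 => /(_ m0) /le_trans; apply.
rewrite -mulrA ler_wpM2l ?exprn_ge0// natrM natrX -mulrA ler_wpM2l ?exprn_ge0//.
have c0 : 0 <= c by rewrite (le_trans _ mc).
rewrite mulrA exprMn; apply: ler_pM.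
- by rewrite mulr_ge0// ler0n.
- exact: powR_ge0.
(* [(m + 1)^(2m) * 2m <= (2m)^(2m) * 2^(2m)]. *)
- apply: le_trans (_ : ((4 * m) ^ m.*2)%:R <= _); last first.
    by rewrite natrX lerXn2r// nnegrE.
  rewrite -natrM ler_nat (_ : 4 * m = (2 * m) * 2)%N; last by lia.
  rewrite expnMn leq_mul//; first by rewrite leq_exp2r ?double_gt0//; lia.
  by rewrite ltnW// ltn_expl.
- have -> : (m.*2)%:R `^ (B * (m.*2)%:R) = ((m.*2)%:R `^ B) ^+ m.*2 :> R.
    by rewrite powRrM powR_mulrn// powR_ge0.
  rewrite lerXn2r ?nnegrE ?powR_ge0// ge0_ler_powR ?nnegrE ?(ltW B_gt0)//.
  by rewrite (le_trans _ mc)// ler_nat; lia.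
Qed.

(** Every exceptional event is treated with [2 m] factors of [W], where [p <= m <= 2 p]: the lower
    bound gives probability [expR (- (4 * p))] up to powers of [N], the upper one explains [8 * p].
    The [N] diagonal events cost [N^2] each, the [k * n0 * N] others cost [N] each. *)
Lemma good_event k (e : 'I_k -> 'cV[R]_N) (H c K : R) (n0 p : nat) :
  (0 < N)%N -> (0 < p)%N -> (n0 <= p)%N -> (8 * p)%:R <= c -> 1 <= H ->
  H * (c * c `^ B) * expR 2 <= K ->
  (forall j l, `|e j l 0| <= H / Num.sqrt N%:R) ->
  exists bad : set T, [/\ measurable bad,
    fine (P bad) <= (N%:R ^+ 3 + (k * n0)%:R * N%:R ^+ 2) * expR (- (4 * p%:R)) &
    forall w, ~ bad w ->
      (forall l, N%:R * iter_mx (W w) (p + p) (delta_mx l 0) l 0 <=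
         (K * Num.sqrt N%:R) ^+ (p + p)) /\
      (forall j n l, (0 < n <= n0)%N ->
         `|iter_mx (W w) n (e j) l 0| <=
           (K * Num.sqrt N%:R) ^+ n / Num.sqrt N%:R)].
Proof.
move=> N0 p0 n0p pc H1 HK eH.
have [L LE] : exists L, L = c * c `^ B by eexists.
rewrite -LE in HK.
have N1 : 0 < N%:R :> R by rewrite ltr0n.
have c_gt0 : 0 < c by rewrite (lt_le_trans _ pc)// ltr0n muln_gt0.
have L_gt0 : 0 < L by rewrite LE mulr_gt0// powR_gt0.
have H_gt0 : 0 < H by rewrite (lt_le_trans ltr01).
have K_gt0 : 0 < K by rewrite (lt_le_trans _ HK)// !mulr_gt0// expR_gt0.
set S := Num.sqrt N%:R.
have S_gt0 : 0 < S by rewrite sqrtr_gt0.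
have S2 : S ^+ 2 = N%:R by rewrite sqr_sqrtr// ltW.
(* The factor [expR 2] between [H * L] and [K] is gained [2 m] times. *)
have LK m : H ^+ m.*2 * L ^+ m.*2 / K ^+ m.*2 <= expR (- (4 * m%:R)).
  rewrite -exprMn -expr_div_n (_ : expR _ = expR (- 2) ^+ m.*2); last first.
    by rewrite -expRM_natr -muln2 natrM; congr expR; ring.
  apply: lerXn2r; rewrite ?nnegrE ?expR_ge0 ?divr_ge0 ?mulr_ge0 ?(ltW H_gt0)
    ?(ltW L_gt0) ?(ltW K_gt0)//.
  by rewrite ler_pdivrMr// expRN [leRHS]mulrC ler_pdivlMr ?expR_gt0.
have expm m : (p <= m)%N -> expR (- (4 * m%:R)) <= expR (- (4 * p%:R)) :> R.
  by move=> pm; rewrite ler_expR lerN2 ler_wpM2l// ler_nat.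
(* A first moment suffices here: the entry is [|W^p delta_l|^2], hence nonnegative, and already has
   [2 p] factors. *)
pose A1 l := [set w | (K * S) ^+ (p + p) / N%:R <=
  iter_mx (W w) (p + p) (delta_mx l 0) l 0 ^+ 1].
(* The order [2 q] is even, for positivity, and puts [q * n] between [p] and [2 p] whatever [n <= p]
   is. *)
pose q (n : nat) := (p %/ n).+1.
pose A2 (i : 'I_k * 'I_n0 * 'I_N) :=
  let n := i.1.2.+1 in
  [set w | ((K * S) ^+ n / S) ^+ (q n).*2 <= iter_mx (W w) n (e i.1.1) i.2 0 ^+ (q n).*2].
have h1 l : measurable (A1 l) /\ fine (P (A1 l)) <= N%:R ^+ 2 * expR (- (4 * p%:R)).
  have [|||||w|mA hA] := @iter_mx_tail (p + p) (delta_mx l 0) l 1 p 1 c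
    ((K * S) ^+ (p + p) / N%:R).
  - by rewrite mul1n addnn.
  - by [].
  - by move=> i; rewrite mxE; case: (_ && _); rewrite ?normr1 ?normr0.
  - by rewrite (le_trans _ pc)// ler_nat leq_mul2r orbT.
  - by rewrite divr_gt0// exprn_gt0// mulr_gt0.
  - rewrite expr1 -dot_delta iter_mx_add iter_mx_sym ?dot_ge0//.
    by apply/matrixP => i j; rewrite !mxE; case: ltngtP => // /val_inj ->.
  split => //; apply: (le_trans hA); rewrite expr1n mul1r -LE.
  apply: le_trans (_ : N%:R ^+ 2 * (H ^+ p.*2 * L ^+ p.*2 / K ^+ p.*2) <= _); last first.
    by rewrite ler_wpM2l ?exprn_ge0.
  rewrite addnn exprMn -muln2 mulnC (exprM S) S2.
  rewrite invfM invrK.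
  have -> : N%:R ^+ p.+1 * L ^+ (2 * p) * ((K ^+ (2 * p) * N%:R ^+ p)^-1 * N%:R) =
      N%:R ^+ 2 * (1 * L ^+ (2 * p) / K ^+ (2 * p)) :> R.
    by rewrite exprS; field; rewrite !expf_neq0 ?gt_eqF.
  rewrite ler_wpM2l ?exprn_ge0// ler_pM2r ?invr_gt0 ?exprn_gt0//.
  by rewrite ler_pM2r ?exprn_gt0// exprn_ege1.
have h2 i : measurable (A2 i) /\ fine (P (A2 i)) <= N%:R * expR (- (4 * p%:R)).
  case: i => -[j n'] l; rewrite /A2 /=; set n := n'.+1.
  have n_le : (n <= p)%N by rewrite (leq_trans (ltn_ord n')).
  have qn1 : (p <= q n * n)%N by rewrite ltnW// /q -ltn_divLR.
  have qn2 : (q n * n <= 2 * p)%N.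
    by rewrite /q mulSn mul2n -addnn leq_add// leq_divM.
  have [|||||w|mA hA] := @iter_mx_tail n (e j) l (q n).*2 (q n * n) (H / S) c
      (((K * S) ^+ n / S) ^+ (q n).*2).
  - by rewrite -doubleMl.
  - by rewrite (leq_trans p0).
  - exact: eH.
  - rewrite (le_trans _ pc)// ler_nat.
    rewrite (leq_trans (_ : _ <= 4 * (2 * p)))%N ?leq_mul2l ?qn2//.
    by rewrite mulnA.
  - by rewrite exprn_gt0// divr_gt0// exprn_gt0// mulr_gt0.
  - by rewrite -mul2n exprM exprn_ge0// sqr_ge0.
  split => //; apply: (le_trans hA); rewrite -LE.
  set m := (q n * n)%N in qn1 qn2 *.
  apply: le_trans (_ : N%:R * (H ^+ m.*2 * L ^+ m.*2 / K ^+ m.*2) <= _); last first.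
    by rewrite ler_wpM2l// (le_trans (LK m))// expm.
  have -> : ((K * S) ^+ n / S) ^+ (q n).*2 = K ^+ m.*2 * N%:R ^+ m / S ^+ (q n).*2.
    rewrite expr_div_n -exprM mulnC -doubleMl -/m exprMn; congr (_ * _ / _).
    by rewrite -muln2 mulnC exprM S2.
  rewrite expr_div_n.
  (* The size [H / S] of the entries matches the [1 / S] in the threshold, so one factor [N]
     survives. Then [1 <= H] allows its exponent to be raised to [m.*2]. *)
  have -> : H ^+ (q n).*2 / S ^+ (q n).*2 * N%:R ^+ m.+1 * L ^+ m.*2 /
      (K ^+ m.*2 * N%:R ^+ m / S ^+ (q n).*2) =
      N%:R * (H ^+ (q n).*2 * L ^+ m.*2 / K ^+ m.*2).
    by rewrite exprS; field; rewrite !expf_neq0 ?gt_eqF.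
  rewrite ler_wpM2l// ler_pM2r ?invr_gt0 ?exprn_gt0// ler_pM2r ?exprn_gt0//.
  by rewrite ler_weXn2l// leq_double leq_pmulr.
have [mU1 PU1] := union_bound h1; have [mU2 PU2] := union_bound h2.
exists ([set w | exists l, A1 l w] `|` [set w | exists i, A2 i w]); split.
- exact: measurableU.
- rewrite (le_trans (fine_probU mU1 mU2 PU1 PU2))// !card_prod !card_ord.
  rewrite !natrM exprS; lra.
- move=> w /not_orP[/forallNP nA1 /forallNP nA2]; split=> [l|j n l /andP[n1 n2]].
    have /negP := nA1 l; rewrite -ltNge expr1 => /ltW.
    by rewrite ler_pdivlMr// mulrC.
  case: n n1 n2 => // n _ n2.
  have /negP : ~ (((K * S) ^+ n.+1 / S) ^+ (q n.+1).*2 <=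
      iter_mx (W w) n.+1 (e j) l 0 ^+ (q n.+1).*2) := nA2 (j, Ordinal n2, l).
  rewrite -ltNge -(mul2n (q n.+1)) [X in X < _]exprM -real_normK ?num_real// -exprM.
  have t0 : 0 <= (K * S) ^+ n.+1 / S.
    by rewrite divr_ge0 ?exprn_ge0 ?mulr_ge0 ?(ltW K_gt0) ?(ltW S_gt0).
  by rewrite ltr_pXn2r ?muln_gt0 ?nnegrE ?t0 ?normr_ge0// => /ltW.
Qed.

End TailBounds.


(** * Riemann sums of Lipschitz functions *)

Section RiemannSums.
Context {R : realType}.
Notation mu := (@lebesgue_measure R).

Lemma lipschitz01 (h : R -> R) : [lipschitz h x | x in `[0, 1]%classic] ->
  exists2 M : R, 0 < M & forall x y, 0 <= x <= 1 -> 0 <= y <= 1 ->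
    `|h x - h y| <= M * `|x - y|.
Proof.
move=> /pinfty_ex_gt0[M M0 hM]; exists M => // x y x01 y01.
by apply: (hM (x, y)); split => /=; rewrite in_itv/=.
Qed.

Lemma lipschitz01_bounded (h : R -> R) (M : R) : 0 < M ->
  (forall x y, 0 <= x <= 1 -> 0 <= y <= 1 -> `|h x - h y| <= M * `|x - y|) ->
  forall x, 0 <= x <= 1 -> `|h x| <= `|h 0| + M.
Proof.
move=> M0 hM x x01; have /(le_trans _) := hM x 0 x01 ltac:(by rewrite lexx ler01).
have : `|h x| <= `|h 0| + `|h x - h 0|.
  by rewrite -{1}(subrK (h 0) (h x)) addrC ler_normD.
rewrite subr0 => h1 h2; apply: (le_trans h1); rewrite lerD2l.
rewrite (le_trans (hM x 0 x01 _)) ?lexx ?ler01// subr0 ler_piMr ?(ltW M0)//.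
by case/andP: x01 => ? ?; rewrite ger0_norm.
Qed.

Lemma lipschitz01_integrable (g : R -> R) (M : R) : 0 < M ->
  (forall x y, 0 <= x <= 1 -> 0 <= y <= 1 -> `|g x - g y| <= M * `|x - y|) ->
  mu.-integrable `[0, 1] (EFin \o g).
Proof.
move=> M0 hM; apply: continuous_compact_integrable; first exact: segment_compact.
apply/continuous_within_itvP; rewrite ?ltr01//.
have cvgM (x : R) (F : set_system R) : Filter F -> 0 <= x <= 1 ->
    F --> x -> (\forall y \near F, 0 <= y <= 1) -> g y @[y --> F] --> g x.
  move=> FF x01 Fx F01; apply/cvgrPdist_le => e e0; near=> y.
  rewrite (le_trans (hM _ _ x01 _))//; first by near: y.
  rewrite -ler_pdivlMl// mulrC; near: y.
  by move/cvgrPdist_le : Fx; apply; rewrite divr_gt0.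
split.
- move=> x /[!in_itv]/= /andP[x0 x1]; apply: cvgM => //; first by rewrite !ltW.
  near=> y; apply/andP; split; apply: ltW; near: y.
    exact: lt_nbhsr.
  exact: lt_nbhsl.
- apply: cvgM; first by rewrite lexx ler01.
    exact: cvg_at_right_filter.
  near=> y; apply/andP; split; apply: ltW; near: y.
    exact: nbhs_right_gt.
  exact: nbhs_right_lt.
- apply: cvgM; first by rewrite lexx ler01.
    exact: cvg_at_left_filter.
  near=> y; apply/andP; split; apply: ltW; near: y.
    exact: nbhs_left_gt.
  exact: nbhs_left_lt.
Unshelve. all: by end_near. Qed.

(** On each of the [N] cells, of length [1 / N], [g] differs from its value at the right endpoint by
    at most [M / N]; the errors [M / N^2] add up. *)
Lemma riemann_sum_lipschitz (g : R -> R) (M : R) (N : nat) : (0 < N)%N -> 0 < M ->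
  (forall x y, 0 <= x <= 1 -> 0 <= y <= 1 -> `|g x - g y| <= M * `|x - y|) ->
  `|\sum_(l < N) g (gridpt l) / N%:R - \int[mu]_(x in `[0, 1]) g x| <= M / N%:R.
Proof.
move=> N0 M0 hM; have N1 : 0 < N%:R :> R by rewrite ltr0n.
have ig := lipschitz01_integrable M0 hM.
have step n : (n <= N)%N ->
    `|\sum_(l < n) g (l.+1%:R / N%:R) / N%:R -
      \int[mu]_(x in `[0, n%:R / N%:R]) g x| <= n%:R * (M / N%:R ^+ 2).
  elim: n => [|n IH] nN.
    by rewrite big_ord0 mul0r set_itv1 Rintegral_set1 subr0 normr0 mul0r.
  pose a : R := n%:R / N%:R; pose b : R := n.+1%:R / N%:R; rewrite -/b.
  have a0 : 0 <= a by rewrite divr_ge0.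
  have ab : a <= b by rewrite ler_pM2r ?invr_gt0// ler_nat.
  have b1 : b <= 1 by rewrite ler_pdivrMr// mul1r ler_nat.
  have ib : mu.-integrable `[0, b] (EFin \o g).
    by apply: integrableS ig => //; apply: subset_itvl; rewrite bnd_simp.
  have iab : mu.-integrable `]a, b] (EFin \o g).
    by apply: integrableS ib => //; apply: subset_itvr; rewrite bnd_simp.
  have mab : fine (mu `]a, b]) = N%:R^-1.
    rewrite lebesgue_measure_itv/= lte_fin ifT; last first.
      by rewrite ltr_pM2r ?invr_gt0// ltr_nat.
    by rewrite -EFinD/= /a /b -mulrBl -natrB ?subSnn ?mul1r.
  have E : \int[mu]_(x in `[0, b]) g x =
      \int[mu]_(x in `[0, a]) g x + \int[mu]_(x in `]a, b]) g x.
    by rewrite -(Rintegral_itvB (x := a) ib) ?bnd_simp// addrC subrK.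
  rewrite big_ord_recr /= E -/b.
  have cell : `|g b / N%:R - \int[mu]_(x in `]a, b]) g x| <= M / N%:R ^+ 2.
    have -> : g b / N%:R = \int[mu]_(x in `]a, b]) g b by rewrite Rintegral_cst// mab.
    have ic c : mu.-integrable `]a, b] (EFin \o cst c).
      apply: integrableS (_ : mu.-integrable `[0, 1] _) => //.
        by apply: subset_itv; rewrite bnd_simp.
      apply: continuous_compact_integrable; first exact: segment_compact.
      by move=> x; exact: cst_continuous.
    rewrite -RintegralB//; last exact: ic.
    have id : mu.-integrable `]a, b] (EFin \o (fun x => g b - g x)).
      have -> : EFin \o (fun x => g b - g x) = ((EFin \o cst (g b)) \- (EFin \o g))%E by [].
      by apply: integrableB => //; exact: ic.
    rewrite (le_trans (le_normr_Rintegral _ id))//.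
    apply: (@le_trans _ _ (\int[mu]_(x in `]a, b]) (M / N%:R))).
      apply: le_Rintegral => //; [exact: integrable_norm|exact: ic|].
      move=> x /=; rewrite in_itv/= => /andP[ax xb].
      rewrite (le_trans (hM _ _ _ _)) ?b1 ?(le_trans a0) ?(ltW ax) ?(le_trans xb)//.
      rewrite ler_wpM2l ?(ltW M0)// ger0_norm ?subr_ge0//.
      apply: (@le_trans _ _ (b - a)); first by rewrite lerB// ltW.
      by rewrite /a /b -mulrBl -natrB ?subSnn ?mul1r.
    by rewrite Rintegral_cst// mab expr2 invfM mulrA.
  have := IH (ltnW nN); rewrite -/a -natr1 mulrDl mul1r => IHn.
  rewrite opprD addrACA (le_trans (ler_normD _ _))//.
  exact: lerD.
have := step N (leqnn _); rewrite divff ?gt_eqF//.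
have -> : N%:R * (M / N%:R ^+ 2) = M / N%:R by field; rewrite gt_eqF.
by [].
Qed.

End RiemannSums.


(** * Asymptotics *)

(** The Gram matrix of the discretized vectors consists of Riemann sums for the inner products of
    the [h i], and a product of bounded Lipschitz functions is Lipschitz. *)
Lemma evec_bounds (R : realType) (k : nat) (h : 'I_k -> R -> R) :
  (forall i : 'I_k, [lipschitz h i x | x in `[0, 1]%classic]) ->
  (forall i j : 'I_k,
     (\int[lebesgue_measure]_(x in `[0%R, 1%R]) (h i x * h j x)%R%:E
        = (i == j)%:R%R%:E)%E) ->
  exists H M : R, [/\ 1 <= H, 0 <= M & forall N, (0 < N)%N ->
    (forall j l, `|evec N (h j) l 0| <= H / Num.sqrt N%:R) /\
    forall i j, `|dot (evec N (h i)) (evec N (h j)) - (i == j)%:R| <= M / N%:R].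
Proof.
move=> lip orth.
have /choice[L LP] : forall i, exists L : R, 0 < L /\ forall x y, 0 <= x <= 1 ->
    0 <= y <= 1 -> `|h i x - h i y| <= L * `|x - y|.
  by move=> i; have [L L0 hL] := lipschitz01 (lip i); exists L.
pose b i : R := `|h i 0| + L i.
have bP i x : 0 <= x <= 1 -> `|h i x| <= b i.
  by apply: lipschitz01_bounded; [exact: (LP i).1|exact: (LP i).2].
have b0 i : 0 <= b i by rewrite addr_ge0// ltW// (LP i).1.
(* The sum dominates each of its terms and so serves for all pairs; [+ 1] makes the Lipschitz
   constant of each product visibly positive. *)
pose M := \sum_i \sum_j (b i * L j + L i * b j + 1).
have M_ge i j : b i * L j + L i * b j + 1 <= M.
  have t0 i' j' : 0 <= b i' * L j' + L i' * b j' + 1.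
    by rewrite !addr_ge0// mulr_ge0// ltW// (LP _).1.
  rewrite /M (bigD1 i)//=; apply: ler_wpDr.
    by apply: sumr_ge0 => i' _; apply: sumr_ge0 => j' _.
  by rewrite (bigD1 j)//=; apply: ler_wpDr => //; apply: sumr_ge0 => j' _.
have grid01 N (l : 'I_N) : 0 <= (gridpt l : R) <= 1.
  rewrite divr_ge0//= ler_pdivrMr ?mul1r ?ler_nat//.
  by rewrite ltr0n (leq_ltn_trans _ (ltn_ord l)).
exists (1 + \sum_i b i), M; split.
- by rewrite lerDl sumr_ge0.
- apply: sumr_ge0 => i _; apply: sumr_ge0 => j _.
  by rewrite !addr_ge0// mulr_ge0// ltW// (LP _).1.
move=> N N0; have N1 : 0 < N%:R :> R by rewrite ltr0n.
split=> [j l|i j].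
  rewrite mxE normrM normfV (ger0_norm (sqrtr_ge0 _)) ler_wpM2r ?invr_ge0//.
  rewrite (le_trans (bP _ _ (grid01 N l)))// (bigD1 j)//= addrCA lerDl.
  by rewrite addr_ge0// sumr_ge0.
have -> : dot (evec N (h i)) (evec N (h j)) =
    \sum_(l < N) (h i (gridpt l) * h j (gridpt l)) / N%:R.
  rewrite dotE; apply: eq_bigr => l _; rewrite !mxE mulrACA -invfM -expr2.
  by rewrite sqr_sqrtr ?ltW.
have M0 : 0 < b i * L j + L i * b j + 1.
  by rewrite ltr_wpDl// addr_ge0// mulr_ge0// ltW// (LP _).1.
have := @riemann_sum_lipschitz R (fun x => h i x * h j x) _ N N0 M0.
have -> : \int[lebesgue_measure]_(x in `[0, 1]) (h i x * h j x) = (i == j)%:R :> R.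
  by rewrite /Rintegral orth.
move=> Hr; apply: (le_trans (Hr _)); last by rewrite ler_pM2r ?invr_gt0.
move=> x y x01 y01.
have -> : h i x * h j x - h i y * h j y =
    h i x * (h j x - h j y) + (h i x - h i y) * h j y by ring.
apply: (@le_trans _ _ (b i * (L j * `|x - y|) + L i * `|x - y| * b j)).
  rewrite (le_trans (ler_normD _ _))// !normrM.
  by rewrite lerD// ler_pM// ?bP//; [exact: (LP j).2|exact: (LP i).2].
rewrite -subr_ge0 (_ : _ - _ = `|x - y|)//.
by move: (b i) (b j) (L i) (L j) => *; ring.
Qed.

Lemma near_ln_powR (R : realType) (a A : R) : 0 < a ->
  \forall N \near \oo, A <= ln N%:R `^ a.
Proof.
move=> a0; near=> N.
have [A0|A0] := leP A 0; first by rewrite (le_trans A0)// powR_ge0.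
have -> : A = (A `^ a^-1) `^ a by rewrite -powRrM mulVf ?gt_eqF// powRr1// ltW.
have lnA : A `^ a^-1 <= ln N%:R.
  rewrite -[leLHS]expRK ler_ln ?posrE ?expR_gt0//; last first.
    by rewrite ltr0n; near: N; exact: nbhs_infty_gt.
  by near: N; exact: nbhs_infty_ger.
by rewrite ge0_ler_powR ?nnegrE ?powR_ge0// ?(ltW a0)// (le_trans _ lnA)// powR_ge0.
Unshelve. all: by end_near. Qed.

(** Failure need only be covered by some measurable set, and only for large [N]. *)
Lemma whp_of_bad (R : realType) (d : nat -> measure_display)
    (T : forall N, measurableType (d N)) (P : forall N, probability (T N) R)
    (E : forall N, set (T N)) (eta M : R) :
  (forall N, measurable (E N)) -> 1 < eta ->
  (\forall N \near \oo, exists bad : set (T N), [/\ measurable bad,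
     fine (P N bad) <= M * expR (- (ln N%:R `^ eta)) & ~` E N `<=` bad]) ->
  whp P E.
Proof.
move=> mE eta1 h; split => //; exists eta => //.
apply/eqO_exP; exists (`|M| + 1); first by rewrite ltr_wpDl.
near=> N; have [bad [mb Pb Eb]] : exists bad : set (T N), [/\ measurable bad,
     fine (P N bad) <= M * expR (- (ln N%:R `^ eta)) & ~` E N `<=` bad].
  by near: N.
have mC := measurableC (mE N).
rewrite (ger0_norm (expR_ge0 _)) ger0_norm ?fine_ge0 ?measure_ge0//.
apply: le_trans (_ : fine (P N bad) <= _).
  by rewrite fine_le ?fin_num_measure// le_measure ?inE.
rewrite (le_trans Pb)// ler_wpM2r ?expR_ge0// (le_trans (ler_norm M))//.
by rewrite lerDl.
Unshelve. all: by end_near. Qed.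

(** Two demands on [p] compete: the tail and the union bound need [p] at least [(log N)^eta], while
    [(8 p)^(B + 1)] must stay below [(log N)^(xi / 4)] up to constants. Rounding [(log N)^eta] up
    meets both. *)
Lemma near_parameters (R : realType) (k : nat) (theta : nat -> R)
    (B xi eta H M c delta : R) :
  0 < B -> 1 < eta -> eta * (B + 1) < xi / 4 -> 0 < xi -> 1 <= H -> 0 <= M ->
  0 < c -> 0 < delta ->
  (forall N, (0 < N)%N -> 0 < theta N) ->
  (fun N => Num.sqrt N%:R * ln N%:R `^ xi) =O_\oo theta ->
  theta =O_\oo (fun N => N%:R : R) ->
  \forall N \near \oo, exists p : nat, let kappa := ln N%:R `^ (xi / 4) * Num.sqrt N%:R in
    [/\ [/\ (k < N)%N, (0 < p)%N & ln N%:R `^ eta <= p%:R],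
        H * ((8 * p)%:R * (8 * p)%:R `^ B) * expR 2 <= ln N%:R `^ (xi / 4),
        M / N%:R <= kappa / theta N, kappa / theta N <= delta &
        (kappa / theta N / c) ^+ p.+1 <= (Num.sqrt N%:R)^-1 * (kappa / theta N) /\
        (N%:R ^+ 3 + (k * p)%:R * N%:R ^+ 2) * expR (- (4 * p%:R)) <=
          (1 + k%:R) * expR (- (ln N%:R `^ eta))].
Proof.
move=> B0 eta1 etaB xi0 H1 M0 c0 delta0 theta_gt0.
move=> /eqO_exP[c1 c1_gt0 low] /eqO_exP[c2 c2_gt0 up].
have beta0 : 0 < xi / 4 - eta * (B + 1) by rewrite subr_gt0.
have xi34 : 0 < 3 * xi / 4 by rewrite divr_gt0// mulr_gt0.
have xi4 : 0 < xi / 4 by rewrite divr_gt0.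
(* The second bound makes [(kappa / theta / c)^p] at most [expR (- 2 p)], which is at most
   [N^-2]. *)
pose delta' := Num.min delta (c * expR (-2)).
have delta'_gt0 : 0 < delta' by rewrite lt_min delta0 mulr_gt0// expR_gt0.
near=> N.
have kN : (k < N)%N by near: N; exact: nbhs_infty_gt.
have N0 : (0 < N)%N by rewrite (leq_ltn_trans _ kN).
have N1 : 0 < N%:R :> R by rewrite ltr0n.
have NE : N%:R = expR (ln N%:R) :> R by rewrite lnK// posrE.
have th0 := theta_gt0 N N0.
have x1 : 1 <= ln N%:R :> R.
  rewrite -[leRHS]powRr1; last by rewrite ln_ge0// ler1n.
  by near: N; exact: near_ln_powR.
have lowN : `|Num.sqrt N%:R * ln N%:R `^ xi| <= c1 * `|theta N| by near: N; exact: low.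
have upN : `|theta N| <= c2 * `|N%:R : R| by near: N; exact: up.
(* Slack in the exponents beats the constants: [kappa / theta] is [O((log N)^(- 3 xi / 4))] for
   [A1], and [8 p <= 16 (log N)^eta] accounts for the 16 in [A2]. *)
have A1 : c1 / delta' <= ln N%:R `^ (3 * xi / 4) by near: N; exact: near_ln_powR.
have A2 : H * 16 `^ (B + 1) * expR 2 <= ln N%:R `^ (xi / 4 - eta * (B + 1)).
  by near: N; exact: near_ln_powR.
have A3 : M * c2 <= ln N%:R `^ (xi / 4) by near: N; exact: near_ln_powR.
have cN : c^-1 <= N%:R by near: N; exact: nbhs_infty_ger.
exists (Num.truncn (ln N%:R `^ eta)).+1 => /=.
have /andP[t1 t2] := truncn_itv (powR_ge0 (ln N%:R) eta).
move: (Num.truncn _) t1 t2 => q t1 t2.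
have [p pE] : exists p, p = q.+1 by eexists.
have p0 : (0 < p)%N by rewrite pE.
rewrite -pE in t2 *; move: (ln N%:R) NE x1 lowN A1 A2 A3 t1 t2 => x NE x1 lowN A1 A2 A3 t1 t2.
have [kappa kaE] : exists kappa, kappa = x `^ (xi / 4) * Num.sqrt N%:R by eexists.
rewrite -kaE.
have x0 : 0 < x by rewrite (lt_le_trans ltr01).
have xeta : x <= x `^ eta by rewrite -[leLHS]powRr1 ?(ltW x0)// ler_powR// ltW.
have phi : p%:R <= 2 * x `^ eta.
  by rewrite pE -natr1 mulr2n mulrDl mul1r lerD// (le_trans x1).
have plo := ltW t2.
have xp : x <= p%:R by rewrite (le_trans xeta).
have S0 : 0 < Num.sqrt N%:R :> R by rewrite sqrtr_gt0.
have S1 : 1 <= Num.sqrt N%:R :> R by rewrite -[leLHS]sqrtr1 ler_sqrt// ler1n.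
have S2 : Num.sqrt N%:R ^+ 2 = N%:R :> R by rewrite sqr_sqrtr// ltW.
have ka0 : 0 <= kappa by rewrite kaE mulr_ge0 ?powR_ge0// ltW.
have kd : kappa / theta N <= delta'.
  rewrite ler_pdivrMr//.
  move: lowN; rewrite (ger0_norm (ltW th0)) ger0_norm ?mulr_ge0 ?powR_ge0 ?(ltW S0)// => h.
  rewrite -(ler_pM2l c1_gt0); apply: le_trans (_ : delta' * (c1 * theta N) <= _); last first.
    by rewrite mulrCA.
  apply: le_trans (ler_wpM2l (ltW delta'_gt0) h).
  have -> : xi = xi / 4 + 3 * xi / 4 by field.
  rewrite powRD; last by rewrite (gt_eqF x0) implybT.
  rewrite ler_pdivrMr// in A1.
  apply: le_trans (ler_wpM2r ka0 A1) _.
  rewrite kaE le_eqVlt; apply/orP; left; apply/eqP.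
  by move: (x `^ (xi / 4)) (x `^ (3 * xi / 4)) (Num.sqrt N%:R) => *; ring.
split.
- by split.
- have B1 : 0 < B + 1 by rewrite addr_gt0.
  have cE : (8 * p)%:R * (8 * p)%:R `^ B = (8 * p)%:R `^ (B + 1) :> R.
    rewrite powRD; last by rewrite (gt_eqF B1).
    by rewrite powRr1// mulrC.
  have c16 : (8 * p)%:R <= 16 * x `^ eta :> R.
    by rewrite natrM; move: phi; clear; lra.
  have -> : xi / 4 = (xi / 4 - eta * (B + 1)) + eta * (B + 1) by ring.
  rewrite powRD; last by rewrite (gt_eqF x0) implybT.
  apply: le_trans (ler_wpM2r (powR_ge0 _ _) A2).
  rewrite cE [leRHS]mulrAC ler_wpM2r ?expR_ge0// -mulrA ler_wpM2l//.
    by rewrite (le_trans ler01).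
  rewrite powRrM -powRM ?powR_ge0// ge0_ler_powR ?nnegrE ?(ltW B1)//.
  by rewrite mulr_ge0 ?powR_ge0.
(* Here [theta = O(N)] enters: the discretization error [M / N] must not exceed [kappa / theta]. *)
- rewrite ler_pdivrMr// mulrAC ler_pdivlMr//.
  move: upN; rewrite (ger0_norm (ltW th0)) ger0_norm// => h.
  rewrite (le_trans (ler_wpM2l M0 h))// mulrA ler_wpM2r// kaE.
  by rewrite (le_trans A3)// ler_peMr// powR_ge0.
- by rewrite (le_trans kd)// ge_min lexx.
- split; last first.
    (* Both [N] and [p] are at most [E = expR p], so the polynomial prefactor is at most
       [(1 + k) * E^3], and a factor [E^-1] remains. *)
    have Np : N%:R <= expR p%:R :> R by rewrite NE ler_expR.
    have pp : p%:R <= expR p%:R :> R by rewrite (le_trans _ (expR_ge1Dx _))// lerDr.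
    set E := expR p%:R in Np pp.
    have E0 : 0 < E by exact: expR_gt0.
    have -> : expR (- (4 * p%:R)) = E ^- 4 by rewrite expRN mulrC expRM_natr.
    apply: (@le_trans _ _ ((1 + k%:R) * E^-1)); last first.
      by rewrite ler_wpM2l// /E -expRN ler_expR lerN2.
    rewrite natrM.
    have -> : (1 + k%:R) / E = (E ^+ 3 + k%:R * E * E ^+ 2) * E ^- 4 by field; rewrite gt_eqF.
    rewrite ler_wpM2r ?invr_ge0 ?exprn_ge0 ?(ltW E0)// lerD ?lerXn2r ?nnegrE ?(ltW E0)//.
    rewrite ler_pM ?mulr_ge0 ?exprn_ge0 ?lerXn2r ?nnegrE ?(ltW E0)//.
    by rewrite ler_wpM2l.
  have y2 : kappa / theta N / c <= expR (-2).
    by rewrite ler_pdivrMr// [leRHS]mulrC (le_trans kd)// ge_min lexx orbT.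
  have y0 : 0 <= kappa / theta N / c by rewrite !divr_ge0 ?(ltW c0) ?(ltW th0).
  rewrite exprS.
  have yp : (kappa / theta N / c) ^+ p <= c / Num.sqrt N%:R.
    apply: (@le_trans _ _ (expR (-2) ^+ p)).
        by apply: lerXn2r; rewrite ?nnegrE ?expR_ge0.
    apply: (@le_trans _ _ (N%:R ^+ 2)^-1).
      rewrite NE -!expRM_natr -expRN ler_expR mulNr lerN2; move: xp; clear; lra.
    have {}cN : N%:R^-1 <= c by rewrite -[leRHS]invrK lef_pV2 ?posrE ?invr_gt0.
    rewrite expr2 invfM ler_pM ?invr_ge0// lef_pV2 ?posrE// -[leRHS]S2 expr2.
    by rewrite ler_peMl// ltW.
  rewrite [leRHS](_ : _ = kappa / theta N / c * (c / Num.sqrt N%:R)).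
    by rewrite ler_wpM2l.
  by field; rewrite !gt_eqF.
Unshelve. all: by end_near. Qed.

Lemma coord_le_normmx (R : realType) N (x : 'cV[R]_N) l : `|x l 0| <= `|x|.
Proof.
rewrite [leRHS]mx_normrE.
exact: (le_bigmax _ (fun ij : 'I_N * 'I_1 => `|x ij.1 ij.2|) (l, 0)).
Qed.

Lemma measurable_normmx_le d (T : measurableType d) (R : realType) (N : nat)
    (v : T -> 'cV[R]_N) (e : 'cV[R]_N) (c : R) : 0 <= c ->
  (forall l, measurable_fun setT (fun w => v w l ord0)) ->
  measurable [set w | `| `|v w - e| | <= c].
Proof.
move=> c0 mv.
have -> : [set w | `| `|v w - e| | <= c] =
    \bigcap_(l in [set: 'I_N]) [set w | `|v w l 0 - e l 0| <= c].
  apply/seteqP; split => w /=; rewrite normr_id.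
    move=> h l _ /=; apply: le_trans h.
    by have := coord_le_normmx (v w - e) l; rewrite mxE [X in _ + X]mxE.
  move=> h; apply: normmx_le => // l; rewrite mxE [X in _ + X]mxE.
  exact: h.
apply: fin_bigcap_measurable => // l _.
have mf : measurable_fun setT (fun w => `|v w l 0 - e l 0|).
  by apply: measurableT_comp => //; exact: measurable_funB.
have := mf measurableT _ (measurable_itv `]-oo, c]); rewrite setTI.
by congr measurable; apply/seteqP; split => w /=; rewrite in_itv.
Qed.

Theorem theorem2p4 (R : realType) (k : nat) (alpha : 'I_k -> R) (B : R)
    (f : R -> R -> R)
    (d : nat -> measure_display) (T : forall N, measurableType (d N))
    (P : forall N, probability (T N) R)
    (X : forall N, 'I_N -> 'I_N -> {RV (P N) >-> R})
    (h : 'I_k -> R -> R) (theta : nat -> R)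
    (v : forall N, 'I_k -> T N -> 'cV[R]_N) (xi : R) :
  let W N w := sym_mx (fun j l => X N j l w) in
  let A N w := perturbed_mx (W N w) (theta N) alpha h in
  (0 < k)%N ->
  (forall i j : 'I_k, (i < j)%N -> alpha j < alpha i) ->
  (forall i : 'I_k, 0 < alpha i) ->
  0 < B ->
  (forall x y : R, x \in `[0, 1] -> y \in `[0, 1] -> 0 <= f x y) ->
  (exists M : R, forall x y : R, x \in `[0, 1] -> y \in `[0, 1] -> f x y <= M) ->
  riemann_integrable_unit_square f ->
  (forall N, mutually_independent [set p : 'I_N * 'I_N | (p.1 <= p.2)%N]
               (fun p => X N p.1 p.2)) ->
  (forall N (j l : 'I_N), (j <= l)%N ->
     [/\ ('E_(P N)[X N j l] = 0)%E,
         ('V_(P N)[X N j l] = (f (gridpt j) (gridpt l))%:E)%E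
       & forall m : nat, (0 < m)%N ->
           ('E_(P N)[fun w => (`|X N j l w| ^+ m)%R]
              <= (m%:R `^ (B * m%:R))%:E)%E]) ->
  (forall N, (0 < N)%N -> 0 < theta N) ->
  (forall N (i : 'I_k) (l : 'I_N),
     measurable_fun setT (fun w => v N i w l ord0)) ->
  (forall N (i : 'I_k), (i < N)%N -> forall w,
     unit_eigenvector (A N w) (lambda (A N w) i) (v N i w) /\
     0 <= ((evec N (h i))^T *m v N i w) ord0 ord0) ->
  Num.max (4 * (B + 1)) 8 < xi ->
  (fun N => Num.sqrt N%:R * ln N%:R `^ xi) =O_\oo theta ->
  theta =O_\oo (fun N => N%:R : R) ->
  (forall i : 'I_k, [lipschitz h i x | x in `[0, 1]%classic]) ->
  (forall i j : 'I_k,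
     (\int[lebesgue_measure]_(x in `[0%R, 1%R]) (h i x * h j x)%R%:E
        = (i == j)%:R%R%:E)%E) ->
  forall i : 'I_k,
    let err N w := `|v N i w - evec N (h i)| in
    Ohp P err (fun N _ => ln N%:R `^ (xi / 4) / theta N) /\
    ohp P err (fun N _ => (Num.sqrt N%:R)^-1).
Proof.
move=> W A k0 alpha_anti alpha_gt0 B0 _ _ _ indep moments theta_gt0 mv eig.
move=> xi_gt low up lip orth i err.
have [H [M [H1 M0 ebounds]]] := evec_bounds lip orth.
have [C [eps0 [c [C0 eps00 c0 bound]]]] :=
  eigenvector_bound k0 alpha_anti alpha_gt0 (le_trans ler01 H1).
have B1 : 0 < 4 * (B + 1) by rewrite mulr_gt0// addr_gt0.
have xiB : 4 * (B + 1) < xi by move: xi_gt; rewrite gt_max => /andP[].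
have xi0 : 0 < xi := lt_trans B1 xiB.
(* The midpoint of the interval of admissible exponents, which is nonempty because
   [4 * (B + 1) < xi]. *)
pose eta := (1 + xi / (4 * (B + 1))) / 2.
have q1 : 1 < xi / (4 * (B + 1)) by rewrite ltr_pdivlMr// mul1r.
have eta1 : 1 < eta by move: q1; rewrite /eta; move: (_ / _) => q; lra.
have etaB : eta * (B + 1) < xi / 4.
  have -> : xi / 4 = xi / (4 * (B + 1)) * (B + 1).
    by field; rewrite gt_eqF// addr_gt0.
  rewrite ltr_pM2r ?addr_gt0//.
  by move: q1; rewrite /eta; move: (xi / _) => q; lra.
(* One event serves both conclusions; [delta] is free because the second needs [kappa / theta]
   arbitrarily small. *)
have key delta : 0 < delta -> \forall N \near \oo, (0 < N)%N /\
    exists bad : set (T N), [/\ measurable bad,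
      fine (P N bad) <= (1 + k%:R) * expR (- (ln N%:R `^ eta)),
      ln N%:R `^ (xi / 4) * Num.sqrt N%:R / theta N <= delta &
      forall w, ~ bad w -> err N w <= C * (ln N%:R `^ (xi / 4) / theta N)].
  move=> delta0; have d0 : 0 < Num.min delta eps0 by rewrite lt_min delta0.
  have params := near_parameters k B0 eta1 etaB xi0 H1 M0 c0 d0 theta_gt0 low up.
  near=> N; have [p] : exists p : nat, let kappa := ln N%:R `^ (xi / 4) * Num.sqrt N%:R in
    [/\ [/\ (k < N)%N, (0 < p)%N & ln N%:R `^ eta <= p%:R],
        H * ((8 * p)%:R * (8 * p)%:R `^ B) * expR 2 <= ln N%:R `^ (xi / 4),
        M / N%:R <= kappa / theta N, kappa / theta N <= Num.min delta eps0 &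
        (kappa / theta N / c) ^+ p.+1 <= (Num.sqrt N%:R)^-1 * (kappa / theta N) /\
        (N%:R ^+ 3 + (k * p)%:R * N%:R ^+ 2) * expR (- (4 * p%:R)) <=
          (1 + k%:R) * expR (- (ln N%:R `^ eta))] by near: N; exact: params.
  move=> /= [[kN p0 xp] HK MN]; rewrite le_min => /andP[ked kee] [tail Pbad].
  have N0 : (0 < N)%N by rewrite (leq_ltn_trans _ kN).
  have S0 : 0 < Num.sqrt N%:R :> R by rewrite sqrtr_gt0 ltr0n.
  have [esup eorth] := ebounds N N0.
  have moms (j l : 'I_N) : (j <= l)%N -> ('E_(P N)[X N j l] = 0)%E /\
      forall m : nat, (0 < m)%N ->
        ('E_(P N)[fun w => (`|X N j l w| ^+ m)%R] <= (m%:R `^ (B * m%:R))%:E)%E.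
    by move=> jl; have [? _ ?] := moments N j l jl.
  have [bad [mb Pb good]] :=
    good_event (indep N) B0 moms N0 p0 (leqnn p) (lexx _) H1 HK esup.
  split => //; exists bad; split => //; first exact: le_trans Pb Pbad.
  move=> w /good[diag walks].
  have sW : (W N w)^T = W N w.
    by apply/matrixP => j l; rewrite !mxE; case: ltngtP => // /val_inj ->.
  have iN : (i < N)%N := ltn_trans (ltn_ord i) kN.
  have [Av sgn] := eig N i iN w.
  have ka0 : 0 <= ln N%:R `^ (xi / 4) * Num.sqrt N%:R.
    by rewrite mulr_ge0 ?powR_ge0// ltW.
  have -> : ln N%:R `^ (xi / 4) / theta N = (Num.sqrt N%:R)^-1 *
      (ln N%:R `^ (xi / 4) * Num.sqrt N%:R / theta N).
    by field; rewrite !gt_eqF// theta_gt0.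
  apply: (bound N (W N w) (fun j => evec N (h j)) (theta N) _ p) => //.
  - exact: theta_gt0.
  - exact: opnorm_of_diag diag.
  - by move=> j l; exact: le_trans (eorth j l) MN.
have measE (D : nat -> R) N : 0 <= D N -> measurable [set w | `|err N w| <= D N].
  by move=> D0; apply: measurable_normmx_le => // l; exact: mv.
split.
  exists C => //; apply: (whp_of_bad (eta := eta) (M := 1 + k%:R)) => //.
    by move=> N; apply: (measE (fun N => C * _)); rewrite mulr_ge0// ltW.
  near=> N; have [N0 [bad [mb Pb _ good]]] : (0 < N)%N /\
    exists bad : set (T N), [/\ measurable bad,
      fine (P N bad) <= (1 + k%:R) * expR (- (ln N%:R `^ eta)),
      ln N%:R `^ (xi / 4) * Num.sqrt N%:R / theta N <= 1 &
      forall w, ~ bad w -> err N w <= C * (ln N%:R `^ (xi / 4) / theta N)].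
    by near: N; exact: key.
  exists bad; split => // w /= nE; apply: contrapT => /good hw; apply: nE.
  by rewrite normr_id (le_trans hw)// ler_wpM2l ?(ltW C0)// ler_norm.
move=> delta delta0; apply: (whp_of_bad (eta := eta) (M := 1 + k%:R)) => //.
  by move=> N; apply: (measE (fun N => delta * _)); rewrite mulr_ge0// ltW.
(* With [delta / C] as tolerance, [C * K / theta] is at most [delta / sqrt N], where
   [K = (log N)^(xi / 4)]. *)
near=> N; have [N0 [bad [mb Pb kd good]]] : (0 < N)%N /\
  exists bad : set (T N), [/\ measurable bad,
    fine (P N bad) <= (1 + k%:R) * expR (- (ln N%:R `^ eta)),
    ln N%:R `^ (xi / 4) * Num.sqrt N%:R / theta N <= delta / C &
    forall w, ~ bad w -> err N w <= C * (ln N%:R `^ (xi / 4) / theta N)].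
  by near: N; apply: key; rewrite divr_gt0.
have S0 : 0 < Num.sqrt N%:R :> R by rewrite sqrtr_gt0 ltr0n.
exists bad; split => // w /= nE; apply: contrapT => /good hw; apply: nE.
rewrite normr_id (le_trans hw)// ger0_norm ?invr_ge0 ?(ltW S0)//.
rewrite ler_pdivlMr//; move: kd; rewrite ler_pdivlMr//; apply: le_trans.
by rewrite le_eqVlt; apply/orP; left; apply/eqP; ring.
Unshelve. all: by end_near. Qed.
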